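(* $$\sum_{i=1}^{\infty } \frac{1}{i^5 \binom{2 i}{i}}= \frac{9}{4} \sqrt{3}\, \pi\, c_8-\frac{19 \zeta_5}{3}+\frac{\pi ^2 \zeta_3}{9}+\frac{9 \sqrt{3}\, \pi }{4}-\frac{\pi ^5}{27 \sqrt{3}}.$$
   Context: $\zeta_n:=\sum_{i=1}^\infty \frac{1}{i^n}$ for integers $n\ge 2$, and $c_8:=\sum_{i=1}^\infty\frac{1}{(3i+1)^4}$ (the sum starts at $i=1$). $\binom{2i}{i}$ is the central binomial coefficient. *)

(* Defs.v *)
From Stdlib Require Import Reals.
From Coquelicot Require Import Coquelicot.
Open Scope R_scope.

(* Coquelicot indexes series from k = 0; sums from i = 1 are written with
   i = S k throughout. [zeta n] is meant for n >= 2, where the series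
   converges. *)
Definition zeta (n : nat) : R := Series (fun k : nat => / INR (S k) ^ n).

Definition c8 : R := Series (fun k : nat => / INR (3 * S k + 1) ^ 4).

(* Stdlib's real-valued [Binomial.C]; a bare [C] would denote Coquelicot's
   type of complex numbers. *)
Definition central_binom (i : nat) : R := Binomial.C (2 * i) i.

(* Main.v *)
Require Import Defs.
From Stdlib Require Import Reals Ranalysis5 Lra Lia.
From Coquelicot Require Import Coquelicot.
Open Scope R_scope.

(** The sum is a log-sine integral in disguise.  Put r = 2 sin(t/2), L = ln r and
    P_k(t) = sum_n r^(2n) / (n^k binom(2n,n)).  Then P_2 = t^2/2 ([cbSeries_2_chord]) and
    P_(k+1)' = 2 L' P_k ([cbSeries_chord_derive]), so that
    P_5 - 2 L P_4 + 2 L^2 P_3 - (2/3) L^3 t^2 has derivative -(4/3) t L^3 on (0, pi/3), while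
    its value at pi/3, where r = 1 and L = 0, is the sum to be computed.

    A second primitive of t L^3 comes from the logarithm l = ln(1 - e^(it)) = L + i f with
    f = (t - pi)/2.  Since t = 2f + pi,
      t L^3 = (1/2) Im l^4 + pi Re l^3 + (2 f^3 + 3 pi f^2) L.
    Powers of l are integrated by repeated parts in terms of Li_k(w), w = 1 - e^(it) = r e^(if),
    because dw/(1 - w) = -i dt.  The remaining term, linear in L, is integrated with the
    Clausen functions Li_k(e^(it)), because Im Li_2(e^(it)) has derivative -L
    ([clausen_2_derive]).  At t = pi/3 the point w is the conjugate of e^(it), so both families
    meet in the same constants; at t = 0 every term carrying a positive power of L vanishes.
    The difference of the two primitives is [chord_primitive]: its derivative is zero, and
    equating its two boundary values gives [cbSeries_5_clausen], which expresses the sum by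
    zeta(3), zeta(5), Re Li_3, Re Li_5 and Im Li_4 at e^(i pi/3).

    Splitting these series modulo 6 turns the real parts into multiples of zeta(3) and zeta(5)
    ([LiRe_PI3]) and the imaginary part into sqrt 3 times a combination of c_8 and zeta(4)
    ([LiIm_4_PI3]).  Finally zeta(4) = pi^4/90 ([zeta_4]) accounts for the pi^5 term; it follows
    from the polynomial formula for Re Li_4(e^(it)).

    Complex numbers appear only through real and imaginary parts, as trigonometric series in
    polar coordinates.  All limits and termwise derivatives rest on dominated convergence for
    series ([tannery]). *)

(** * Series depending on a parameter *)

Lemma ex_series_dominated (a M : nat -> R) :
  ex_series M -> (forall n, Rabs (a n) <= M n) -> ex_series a.
Proof.
  intros HM Ha. apply (@ex_series_le R_AbsRing R_CompleteNormedModule) with M; auto.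
Qed.

Lemma Series_dominated (a M : nat -> R) :
  ex_series M -> (forall n, Rabs (a n) <= M n) -> Rabs (Series a) <= Series M.
Proof.
  intros HM Ha.
  assert (Habs : ex_series (fun n => Rabs (a n))).
  { apply ex_series_dominated with M; auto. intros n; rewrite Rabs_Rabsolu; auto. }
  eapply Rle_trans; [apply Series_Rabs, Habs|].
  apply Series_le; auto. intros n; split; [apply Rabs_pos | auto].
Qed.

Lemma Series_tail_small (M : nat -> R) (eps : R) :
  ex_series M -> 0 < eps ->
  exists N : nat, (0 < N)%nat /\ Rabs (Series (fun k => M (N + k)%nat)) < eps.
Proof.
  intros HM Heps.
  pose proof (Series_correct _ HM) as Hs.
  apply is_series_Reals in Hs. destruct (Hs eps Heps) as [N HN].
  exists (S N). split; [lia|].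
  specialize (HN N (Nat.le_refl N)). unfold Rdist in HN.
  rewrite (Series_incr_n M (S N)) in HN by (auto; lia). simpl pred in HN.
  rewrite Rabs_minus_sym in HN.
  replace (sum_f_R0 M N + Series (fun k => M (S N + k)%nat) - sum_f_R0 M N)
    with (Series (fun k => M (S N + k)%nat)) in HN by ring.
  exact HN.
Qed.

Lemma filterlim_Rplus {T} (F : (T -> Prop) -> Prop) {FF : Filter F} (f g : T -> R) (a b : R) :
  filterlim f F (locally a) -> filterlim g F (locally b) ->
  filterlim (fun x => f x + g x) F (locally (a + b)).
Proof.
  intros Hf Hg. exact (filterlim_comp_2 f g Rplus Hf Hg (filterlim_plus (V := R_NormedModule) a b)).
Qed.

Lemma filterlim_Rmult {T} (F : (T -> Prop) -> Prop) {FF : Filter F} (f g : T -> R) (a b : R) :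
  filterlim f F (locally a) -> filterlim g F (locally b) ->
  filterlim (fun x => f x * g x) F (locally (a * b)).
Proof.
  intros Hf Hg. exact (filterlim_comp_2 f g Rmult Hf Hg (filterlim_mult (K := R_AbsRing) a b)).
Qed.

Lemma filterlim_Rminus {T} (F : (T -> Prop) -> Prop) {FF : Filter F} (f g : T -> R) (a b : R) :
  filterlim f F (locally a) -> filterlim g F (locally b) ->
  filterlim (fun x => f x - g x) F (locally (a - b)).
Proof.
  intros Hf Hg. apply (filterlim_Rplus F); auto.
  exact (filterlim_comp _ _ _ g Ropp F _ _ Hg (filterlim_opp (V := R_NormedModule) b)).
Qed.

Lemma filterlim_Rpow {T} (F : (T -> Prop) -> Prop) {FF : Filter F} (f : T -> R) (a : R) (n : nat) :
  filterlim f F (locally a) -> filterlim (fun x => f x ^ n) F (locally (a ^ n)).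
Proof.
  intros Hf. apply (filterlim_comp _ _ _ f (fun z => z ^ n) F (locally a)); [exact Hf|].
  apply (ex_derive_continuous (fun z => z ^ n)). auto_derive. auto.
Qed.

Lemma squeeze_0 {T} (F : (T -> Prop) -> Prop) {FF : Filter F} (f g : T -> R) :
  F (fun x => Rabs (f x) <= g x) -> filterlim g F (locally 0) -> filterlim f F (locally 0).
Proof.
  intros Hfg Hg. apply filterlim_locally. intros eps.
  generalize (filter_and _ _ Hfg (proj1 (filterlim_locally _ _) Hg eps)).
  apply filter_imp. intros x [H1 H2].
  change (Rabs (g x - 0) < eps) in H2. change (Rabs (f x - 0) < eps).
  rewrite Rminus_0_r in *. pose proof (Rle_abs (g x)). lra.
Qed.

Lemma filterlim_value {T} (F : (T -> Prop) -> Prop) (f : T -> R) (a b : R) :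
  filterlim f F (locally a) -> a = b -> filterlim f F (locally b).
Proof. now intros H <-. Qed.

Lemma filterlim_sum_f_R0 {T} (F : (T -> Prop) -> Prop) {FF : Filter F}
  (f : nat -> T -> R) (l : nat -> R) (n : nat) :
  (forall k, filterlim (f k) F (locally (l k))) ->
  filterlim (fun x => sum_f_R0 (fun k => f k x) n) F (locally (sum_f_R0 l n)).
Proof.
  intros Hf. induction n as [|n IH]; simpl; [apply Hf|].
  apply (filterlim_Rplus F); auto.
Qed.

(** Tannery's theorem along an arbitrary filter.  The majorant makes the tails uniformly
    small, which leaves a finite sum of convergent terms. *)
Theorem tannery {T} (F : (T -> Prop) -> Prop) {FF : ProperFilter F}
  (f : nat -> T -> R) (l M : nat -> R) :
  ex_series M ->
  F (fun x => forall n, Rabs (f n x) <= M n) ->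
  (forall n, filterlim (f n) F (locally (l n))) ->
  filterlim (fun x => Series (fun n => f n x)) F (locally (Series l)).
Proof.
  intros HM Hdom Hlim.
  assert (Hl : forall n, Rabs (l n) <= M n).
  { intros n.
    assert (Hn : F (fun x => Rabs (f n x) <= M n)) by (eapply filter_imp; [|exact Hdom]; auto).
    assert (Habs : filterlim (fun x => Rabs (f n x)) F (locally (Rabs (l n)))).
    { eapply filterlim_comp; [apply Hlim|]. apply (continuous_Rabs (l n)). }
    exact (filterlim_le (F := F) (fun x => Rabs (f n x)) (fun _ => M n)
             (Finite (Rabs (l n))) (Finite (M n)) Hn Habs (filterlim_const (M n))). }
  apply filterlim_locally. intros eps.
  assert (He3 : 0 < eps / 3) by (pose proof (cond_pos eps); lra).
  destruct (Series_tail_small M (eps / 3) HM He3) as [N [HN Htail]].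
  assert (HMN : ex_series (fun k => M (N + k)%nat)).
  { apply (ex_series_incr_n M N); auto. }
  pose proof (proj1 (filterlim_locally _ _)
    (filterlim_sum_f_R0 F f l (pred N) Hlim) (mkposreal _ He3)) as Hsum.
  eapply filter_imp; [|exact (filter_and _ _ Hdom Hsum)].
  intros x [Hx Hxs].
  change (Rabs (Series (fun n => f n x) - Series l) < eps).
  change (Rabs (sum_f_R0 (fun k => f k x) (pred N) - sum_f_R0 l (pred N)) < eps / 3) in Hxs.
  rewrite (Series_incr_n (fun n => f n x) N HN) by (apply ex_series_dominated with M; auto).
  rewrite (Series_incr_n l N HN) by (apply ex_series_dominated with M; auto).
  assert (H1 : Rabs (Series (fun k => f (N + k)%nat x)) <= Series (fun k => M (N + k)%nat))
    by (apply Series_dominated; auto).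
  assert (H2 : Rabs (Series (fun k => l (N + k)%nat)) <= Series (fun k => M (N + k)%nat))
    by (apply Series_dominated; auto).
  assert (H3 := Rle_abs (Series (fun k => M (N + k)%nat))).
  apply Rabs_def2 in Hxs. apply Rabs_le_between in H1. apply Rabs_le_between in H2.
  apply Rabs_def1; lra.
Qed.

(** Termwise differentiation: by the mean value theorem the difference quotients of the terms
    are bounded by the majorant of the derivatives, so Tannery's theorem applies to them. *)
Lemma is_derive_Series (f f' : nat -> R -> R) (M : nat -> R) (x : R) :
  ex_series M ->
  locally x (fun y => forall n, is_derive (f n) y (f' n y) /\ Rabs (f' n y) <= M n) ->
  locally x (fun y => ex_series (fun n => f n y)) ->
  is_derive (fun y => Series (fun n => f n y)) x (Series (fun n => f' n x)).
Proof.
  intros HM [d1 Hd] [d2 Hex].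
  set (d := mkposreal _ (Rmin_stable_in_posreal d1 d2)).
  assert (Hq : filterlim (fun h => Series (fun n => (f n (x + h) - f n x) / h))
                 (locally' 0) (locally (Series (fun n => f' n x)))).
  { apply (tannery (locally' 0) (FF := Rbar_locally'_filter 0)
      (fun n h => (f n (x + h) - f n x) / h) (fun n => f' n x) M); auto.
    - exists d. intros h Hh Hh0 n.
      change (Rabs (h - 0) < d) in Hh. rewrite Rminus_0_r in Hh.
      assert (Hh1 : Rabs h < d1) by (eapply Rlt_le_trans; [exact Hh|apply Rmin_l]).
      assert (Hb : forall y, Rmin x (x + h) <= y <= Rmax x (x + h) -> ball x d1 y).
      { intros y Hy. change (Rabs (y - x) < d1).
        revert Hy Hh1. unfold Rmin, Rmax, Rabs.
        destruct (Rle_dec x (x + h)); destruct (Rcase_abs h); destruct (Rcase_abs (y - x)); lra. }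
      destruct (MVT_gen (f n) x (x + h) (f' n)) as [c [Hc1 Hc2]].
      + intros y Hy. apply Hd, Hb. lra.
      + intros y Hy. apply continuity_pt_filterlim.
        apply (ex_derive_continuous (f n)). eexists. apply Hd, Hb, Hy.
      + rewrite Hc2. replace (f' n c * (x + h - x) / h) with (f' n c) by (field; auto).
        apply Hd, Hb, Hc1.
    - intros n. apply filterlim_locally. intros eps.
      assert (Hn : derivable_pt_lim (f n) x (f' n x)).
      { apply is_derive_Reals, Hd. apply ball_center. }
      destruct (Hn eps (cond_pos eps)) as [e He].
      exists e. intros h Hh Hh0. change (Rabs (h - 0) < e) in Hh. rewrite Rminus_0_r in Hh.
      apply He; auto. }
  apply is_derive_Reals. intros eps Heps.
  destruct (proj1 (filterlim_locally _ _) Hq (mkposreal _ Heps)) as [e He].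
  exists (mkposreal _ (Rmin_stable_in_posreal e d)). intros h Hh0 Hh. simpl in Hh.
  assert (Hhe : Rabs h < e) by (eapply Rlt_le_trans; [exact Hh|apply Rmin_l]).
  assert (Hh2 : Rabs h < d2).
  { eapply Rlt_le_trans; [exact Hh|]. eapply Rle_trans; apply Rmin_r. }
  replace ((Series (fun n => f n (x + h)) - Series (fun n => f n x)) / h)
    with (Series (fun n => (f n (x + h) - f n x) / h)).
  - apply He; auto. change (Rabs (h - 0) < e). now rewrite Rminus_0_r.
  - rewrite <- Series_minus.
    + unfold Rdiv. rewrite <- Series_scal_r. reflexivity.
    + apply Hex. change (Rabs (x + h - x) < d2). now replace (x + h - x) with h by ring.
    + apply Hex, ball_center.
Qed.

Lemma filterlim_id_at_right (a : R) : filterlim (fun x : R => x) (at_right a) (locally a).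
Proof. intros P HP. unfold filtermap. apply filter_le_within. exact HP. Qed.

Lemma at_right_lt (a b : R) : a < b -> at_right a (fun x => a < x < b).
Proof.
  intros Hab. assert (Hp : 0 < b - a) by lra. exists (mkposreal _ Hp).
  intros y Hy Hay. change (Rabs (y - a) < b - a) in Hy. apply Rabs_def2 in Hy. lra.
Qed.

Lemma continuous_at_right (f : R -> R) (a : R) :
  continuous f a -> filterlim f (at_right a) (locally (f a)).
Proof. intros H. eapply filterlim_comp; [apply filterlim_id_at_right|exact H]. Qed.

Lemma filterlim_id_at_left (a : R) : filterlim (fun x : R => x) (at_left a) (locally a).
Proof. intros P HP. unfold filtermap. apply filter_le_within. exact HP. Qed.

Lemma at_left_lt (a b : R) : a < b -> at_left b (fun x => a < x < b).
Proof.
  intros Hab. assert (Hp : 0 < b - a) by lra. exists (mkposreal _ Hp).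
  intros y Hy Hay. change (Rabs (y - b) < b - a) in Hy. apply Rabs_def2 in Hy. lra.
Qed.

Lemma continuous_at_left (f : R -> R) (a : R) :
  continuous f a -> filterlim f (at_left a) (locally (f a)).
Proof. intros H. eapply filterlim_comp; [apply filterlim_id_at_left|exact H]. Qed.

Lemma locally_interval (a b t : R) (P : R -> Prop) :
  a < t < b -> (forall s, a < s < b -> P s) -> locally t P.
Proof.
  intros Ht HP. assert (Hp : 0 < Rmin (t - a) (b - t)) by (apply Rmin_glb_lt; lra).
  exists (mkposreal _ Hp). intros s Hs. change (Rabs (s - t) < Rmin (t - a) (b - t)) in Hs.
  apply HP. pose proof (Rmin_l (t - a) (b - t)). pose proof (Rmin_r (t - a) (b - t)).
  apply Rabs_def2 in Hs. lra.
Qed.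

Lemma is_derive_value (f : R -> R) (x l l' : R) : is_derive f x l' -> l' = l -> is_derive f x l.
Proof. now intros H <-. Qed.

(** The eta-expanded form in which [auto_derive] leaves the derivative of an abstract function. *)
Lemma Derive_eta (f : R -> R) (x l : R) :
  is_derive f x l -> Derive (fun y : R => f y) x = l.
Proof. exact (is_derive_unique f x l). Qed.

Lemma derivative_zero_limit (f : R -> R) (a b l : R) :
  (forall t, a < t < b -> is_derive f t 0) ->
  filterlim f (at_right a) (locally l) ->
  forall t, a < t < b -> f t = l.
Proof.
  intros Hd Hl t Ht.
  assert (Hc : forall s, a < s < b -> f s = f t).
  { intros s Hs.
    destruct (MVT_gen f s t (fun _ => 0)) as [c [_ Hc]].
    - intros y Hy. apply Hd. revert Hy. unfold Rmin, Rmax. destruct (Rle_dec s t); lra.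
    - intros y Hy. apply continuity_pt_filterlim, (ex_derive_continuous f). exists 0. apply Hd.
      revert Hy. unfold Rmin, Rmax. destruct (Rle_dec s t); lra.
    - lra. }
  apply (filterlim_locally_unique (F := at_right a) f); auto.
  apply filterlim_ext_loc with (fun _ => f t); [|apply filterlim_const].
  generalize (at_right_lt a b ltac:(lra)). apply filter_imp.
  intros s Hs. symmetry. now apply Hc.
Qed.

(** This is how all identities between transcendental functions are obtained below: the
    difference of the two sides has derivative zero inside an interval, and only its limits at
    the endpoints, where the functions may be singular, are compared. *)
Lemma derivative_zero_limits (f : R -> R) (a b l l' : R) :
  a < b -> (forall t, a < t < b -> is_derive f t 0) ->
  filterlim f (at_right a) (locally l) -> filterlim f (at_left b) (locally l') -> l' = l.
Proof.
  intros Hab Hd Ha Hb. pose proof (derivative_zero_limit f a b l Hd Ha) as Hc.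
  apply (filterlim_locally_unique (F := at_left b) f); auto.
  apply filterlim_ext_loc with (fun _ => l); [|apply filterlim_const].
  generalize (at_left_lt a b Hab). apply filter_imp.
  intros t Ht. symmetry. now apply Hc.
Qed.

(** * Polylogarithms in polar coordinates *)

Lemma ex_series_mult_l (x : R) (a : nat -> R) :
  ex_series a -> ex_series (fun n => x * a n).
Proof. exact (ex_series_scal_l x a). Qed.

Lemma INR_S_ge_1 (n : nat) : 1 <= INR (S n).
Proof. rewrite S_INR. pose proof (pos_INR n). lra. Qed.

Lemma INR_S_pow_ge_1 (n k : nat) : 1 <= INR (S n) ^ k.
Proof. apply pow_R1_Rle, INR_S_ge_1. Qed.

(** Comparison with the telescoping series of 2 (1/n - 1/(n+1)). *)
Lemma ex_series_inv_pow (k : nat) : (2 <= k)%nat -> ex_series (fun n => / INR (S n) ^ k).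
Proof.
  intros Hk.
  assert (Htel : is_series (fun n => / INR (S n) - / INR (S (S n))) 1).
  { apply is_series_Reals.
    assert (Hsum : forall N, sum_f_R0 (fun n => / INR (S n) - / INR (S (S n))) N
                             = 1 - / INR (S (S N))).
    { induction N as [|N IH]; [simpl; lra|].
      rewrite tech5, IH. lra. }
    intros eps Heps. destruct (archimed_cor1 eps Heps) as [N [HN HN0]].
    exists N. intros n Hn. rewrite Hsum. unfold Rdist.
    replace (1 - / INR (S (S n)) - 1) with (- / INR (S (S n))) by ring.
    rewrite Rabs_Ropp, Rabs_right.
    - eapply Rle_lt_trans; [|exact HN]. apply Rinv_le_contravar.
      + apply lt_0_INR; lia.
      + apply le_INR; lia.
    - apply Rle_ge, Rlt_le, Rinv_0_lt_compat, lt_0_INR; lia. }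
  apply ex_series_dominated with (fun n => 2 * (/ INR (S n) - / INR (S (S n)))).
  - exists (2 * 1). apply (is_series_scal_l 2 _ 1 Htel).
  - intros n. pose proof (INR_S_ge_1 n) as Hn.
    assert (Hk2 : INR (S n) ^ 2 <= INR (S n) ^ k) by (apply Rle_pow; auto).
    rewrite Rabs_right by (apply Rle_ge, Rlt_le, Rinv_0_lt_compat, pow_lt; lra).
    apply Rle_trans with (/ INR (S n) ^ 2);
      [apply Rinv_le_contravar; [apply pow_lt; lra|exact Hk2]|].
    rewrite (S_INR (S n)). set (x := INR (S n)) in *.
    apply Rmult_le_reg_r with (x ^ 2 * (x + 1)); [nra|].
    replace (/ x ^ 2 * (x ^ 2 * (x + 1))) with (x + 1) by (field; lra).
    replace (2 * (/ x - / (x + 1)) * (x ^ 2 * (x + 1))) with (2 * x) by (field; lra).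
    lra.
Qed.

Lemma ex_series_pow_S (q : R) : Rabs q < 1 -> ex_series (fun n => q ^ S n).
Proof.
  intros Hq. apply (ex_series_incr_1 (fun n => q ^ n)), ex_series_geom, Hq.
Qed.

(** For c = cos and c = sin these are the real and imaginary parts of Li_k(r e^(ib)).  A
    general trigonometric function c allows one proof for both parts, and also accommodates
    the derivative -sin of cos. *)
Definition trigLi (c : R -> R) (k : nat) (r b : R) : R :=
  Series (fun n => r ^ S n * c (INR (S n) * b) / INR (S n) ^ k).

Definition LiRe := trigLi cos.
Definition LiIm := trigLi sin.

Lemma trigLi_term_bound (c : R -> R) (c_bound : forall x, Rabs (c x) <= 1)
  (k n : nat) (r b m : R) :
  Rabs (r ^ S n) <= m * INR (S n) ^ k ->
  Rabs (r ^ S n * c (INR (S n) * b) / INR (S n) ^ k) <= m.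
Proof.
  intros H. pose proof (INR_S_pow_ge_1 n k) as Hp.
  unfold Rdiv. rewrite !Rabs_mult, (Rabs_right (/ _)) by
    (apply Rle_ge, Rlt_le, Rinv_0_lt_compat; lra).
  apply Rmult_le_reg_r with (INR (S n) ^ k); [lra|].
  rewrite Rmult_assoc, Rinv_l, Rmult_1_r by lra.
  eapply Rle_trans; [|exact H].
  rewrite <- (Rmult_1_r (Rabs (r ^ S n))) at 2.
  apply Rmult_le_compat_l; [apply Rabs_pos | apply c_bound].
Qed.

Lemma closed_disc_majorant (k n : nat) (r : R) :
  (2 <= k)%nat -> Rabs r <= 1 -> Rabs (r ^ S n) <= / INR (S n) ^ 2 * INR (S n) ^ k.
Proof.
  intros Hk Hr. rewrite <- RPow_abs.
  apply Rle_trans with 1.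
  - rewrite <- (pow1 (S n)). apply pow_incr. split; [apply Rabs_pos|auto].
  - replace k with (2 + (k - 2))%nat by lia. rewrite pow_add, <- Rmult_assoc, Rinv_l.
    + rewrite Rmult_1_l. apply INR_S_pow_ge_1.
    + apply pow_nonzero. pose proof (INR_S_ge_1 n). lra.
Qed.

Lemma open_disc_majorant (k n : nat) (r q : R) :
  Rabs r <= q -> Rabs (r ^ S n) <= q ^ S n * INR (S n) ^ k.
Proof.
  intros Hr. rewrite <- RPow_abs.
  apply Rle_trans with (q ^ S n).
  - apply pow_incr. split; [apply Rabs_pos|auto].
  - rewrite <- (Rmult_1_r (q ^ S n)) at 1. apply Rmult_le_compat_l.
    + apply pow_le. pose proof (Rabs_pos r); lra.
    + apply INR_S_pow_ge_1.
Qed.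

Lemma ex_trigLi_open (c : R -> R) (c_bound : forall x, Rabs (c x) <= 1)
  (k : nat) (r b : R) :
  Rabs r < 1 -> ex_series (fun n => r ^ S n * c (INR (S n) * b) / INR (S n) ^ k).
Proof.
  intros Hr. apply ex_series_dominated with (fun n => Rabs r ^ S n).
  - apply ex_series_pow_S. now rewrite Rabs_Rabsolu.
  - intros n. apply (trigLi_term_bound c c_bound), open_disc_majorant, Rle_refl.
Qed.

Lemma trigLi_bound (c : R -> R) (c_bound : forall x, Rabs (c x) <= 1)
  (k : nat) (r b : R) :
  (2 <= k)%nat -> 0 <= r <= 1 ->
  Rabs (trigLi c k r b) <= r * Series (fun n => / INR (S n) ^ 2).
Proof.
  intros Hk Hr. rewrite <- Series_scal_l. apply Series_dominated.
  - apply ex_series_mult_l. apply ex_series_inv_pow; lia.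
  - intros n. apply (trigLi_term_bound c c_bound).
    simpl pow at 1. rewrite Rabs_mult, (Rabs_right r) by lra.
    rewrite Rmult_assoc. apply Rmult_le_compat_l; [lra|].
    apply Rle_trans with 1.
    + rewrite <- RPow_abs, <- (pow1 n). apply pow_incr. rewrite Rabs_right; lra.
    + eapply Rle_trans; [|apply closed_disc_majorant with (r := 1); auto].
      * rewrite pow1, Rabs_R1. lra.
      * rewrite Rabs_R1. lra.
Qed.

(** The majorant M serves both regimes: geometric inside the disc for every k, and the series
    of inverse squares up to the boundary when k is at least 2. *)
Lemma trigLi_limit (c : R -> R) (c_bound : forall x, Rabs (c x) <= 1)
  (c_cont : forall x, continuous c x) {T} (F : (T -> Prop) -> Prop) {FF : ProperFilter F}
  (M : nat -> R) (k : nat) (r b : T -> R) (r0 b0 : R) :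
  ex_series M ->
  F (fun x => forall n, Rabs (r x ^ S n) <= M n * INR (S n) ^ k) ->
  filterlim r F (locally r0) -> filterlim b F (locally b0) ->
  filterlim (fun x => trigLi c k (r x) (b x)) F (locally (trigLi c k r0 b0)).
Proof.
  intros HM HF Hr Hb. unfold trigLi.
  apply (tannery F (fun n x => r x ^ S n * c (INR (S n) * b x) / INR (S n) ^ k)
           (fun n => r0 ^ S n * c (INR (S n) * b0) / INR (S n) ^ k) M); auto.
  - eapply filter_imp; [|exact HF]. intros x Hx n. apply (trigLi_term_bound c c_bound), Hx.
  - intros n.
    apply (filterlim_Rmult F); [|apply filterlim_const].
    apply (filterlim_Rmult F); [exact (filterlim_Rpow F r r0 (S n) Hr)|].
    apply (filterlim_comp _ _ _ (fun x => INR (S n) * b x) c F (locally (INR (S n) * b0)));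
      [|apply c_cont].
    apply (filterlim_Rmult F); [apply filterlim_const|exact Hb].
Qed.

Lemma trigLi_limit_closed (c : R -> R) (c_bound : forall x, Rabs (c x) <= 1)
  (c_cont : forall x, continuous c x) {T} (F : (T -> Prop) -> Prop) {FF : ProperFilter F}
  (k : nat) (r b : T -> R) (r0 b0 : R) :
  (2 <= k)%nat -> F (fun x => Rabs (r x) <= 1) ->
  filterlim r F (locally r0) -> filterlim b F (locally b0) ->
  filterlim (fun x => trigLi c k (r x) (b x)) F (locally (trigLi c k r0 b0)).
Proof.
  intros Hk HF. apply (trigLi_limit c c_bound c_cont F (fun n => / INR (S n) ^ 2)).
  - apply ex_series_inv_pow; lia.
  - eapply filter_imp; [|exact HF]. intros x Hx n. apply closed_disc_majorant; auto.
Qed.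

Lemma trigLi_limit_open (c : R -> R) (c_bound : forall x, Rabs (c x) <= 1)
  (c_cont : forall x, continuous c x) {T} (F : (T -> Prop) -> Prop) {FF : ProperFilter F}
  (q : R) (k : nat) (r b : T -> R) (r0 b0 : R) :
  0 <= q < 1 -> F (fun x => Rabs (r x) <= q) ->
  filterlim r F (locally r0) -> filterlim b F (locally b0) ->
  filterlim (fun x => trigLi c k (r x) (b x)) F (locally (trigLi c k r0 b0)).
Proof.
  intros Hq HF. apply (trigLi_limit c c_bound c_cont F (fun n => q ^ S n)).
  - apply ex_series_pow_S. rewrite Rabs_right; lra.
  - eapply filter_imp; [|exact HF]. intros x Hx n. apply open_disc_majorant; auto.
Qed.

(** The chain rule for Li_(k+1)(e^(u + ib)), whose derivative is (u' + i b') Li_k: here lam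
    is the logarithmic derivative of the modulus r and bet the derivative of the argument b. *)
Lemma trigLi_derive (c : R -> R) (c_bound : forall x, Rabs (c x) <= 1)
  (d : R -> R) (d_bound : forall x, Rabs (d x) <= 1) (c_derive : forall x, is_derive c x (d x))
  (M : nat -> R) (k : nat) (r b lam bet : R -> R) (t : R) :
  ex_series M ->
  continuous lam t -> continuous bet t ->
  locally t (fun s => is_derive r s (r s * lam s) /\ is_derive b s (bet s) /\
                      forall n, Rabs (r s ^ S n) <= M n * INR (S n) ^ k) ->
  is_derive (fun s => trigLi c (S k) (r s) (b s)) t
    (lam t * trigLi c k (r t) (b t) + bet t * trigLi d k (r t) (b t)).
Proof.
  intros HM Hlam Hbet Hloc.
  set (B := Rabs (lam t) + Rabs (bet t) + 2).
  assert (HB : locally t (fun s => Rabs (lam s) + Rabs (bet s) <= B)).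
  { assert (Hl := proj1 (filterlim_locally _ _) Hlam (mkposreal 1 Rlt_0_1)).
    assert (Hb := proj1 (filterlim_locally _ _) Hbet (mkposreal 1 Rlt_0_1)).
    generalize (filter_and _ _ Hl Hb). apply filter_imp. intros s [H1 H2].
    change (Rabs (lam s - lam t) < 1) in H1. change (Rabs (bet s - bet t) < 1) in H2.
    pose proof (Rabs_triang_inv (lam s) (lam t)).
    pose proof (Rabs_triang_inv (bet s) (bet t)). unfold B. lra. }
  assert (Hmaj : forall s, Rabs (lam s) + Rabs (bet s) <= B ->
            (forall n, Rabs (r s ^ S n) <= M n * INR (S n) ^ k) ->
            forall n, Rabs (lam s * (r s ^ S n * c (INR (S n) * b s) / INR (S n) ^ k)
                      + bet s * (r s ^ S n * d (INR (S n) * b s) / INR (S n) ^ k)) <= B * M n).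
  { intros s HBs HMs n.
    eapply Rle_trans; [apply Rabs_triang|]. rewrite (Rabs_mult (lam s)), (Rabs_mult (bet s)).
    pose proof (trigLi_term_bound c c_bound k n (r s) (b s) (M n) (HMs n)) as Hc.
    pose proof (trigLi_term_bound d d_bound k n (r s) (b s) (M n) (HMs n)) as Hd.
    assert (HM0 : 0 <= M n) by (eapply Rle_trans; [apply Rabs_pos|exact Hc]).
    apply Rle_trans with ((Rabs (lam s) + Rabs (bet s)) * M n).
    - rewrite Rmult_plus_distr_r.
      apply Rplus_le_compat; apply Rmult_le_compat_l; auto using Rabs_pos.
    - apply Rmult_le_compat_r; auto. }
  assert (Hex : forall e, (forall x, Rabs (e x) <= 1) -> forall k' s, (k <= k')%nat ->
            (forall n, Rabs (r s ^ S n) <= M n * INR (S n) ^ k) ->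
            ex_series (fun n => r s ^ S n * e (INR (S n) * b s) / INR (S n) ^ k')).
  { intros e He k' s Hk' HMs. apply ex_series_dominated with M; auto. intros n.
    apply (trigLi_term_bound e He).
    eapply Rle_trans; [apply HMs|]. apply Rmult_le_compat_l.
    - pose proof (INR_S_pow_ge_1 n k) as Hp.
      pose proof (Rabs_pos (r s ^ S n)). specialize (HMs n). nra.
    - apply Rle_pow; auto using INR_S_ge_1. }
  assert (Ht := locally_singleton _ _ Hloc). destruct Ht as [_ [_ Ht]].
  unfold trigLi at 2 3. rewrite <- !Series_scal_l.
  rewrite <- Series_plus.
  2: { apply ex_series_mult_l. apply Hex; auto. }
  2: { apply ex_series_mult_l. apply Hex; auto. }
  unfold trigLi.
  apply (is_derive_Series
    (fun n s => r s ^ S n * c (INR (S n) * b s) / INR (S n) ^ S k)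
    (fun n s => lam s * (r s ^ S n * c (INR (S n) * b s) / INR (S n) ^ k)
              + bet s * (r s ^ S n * d (INR (S n) * b s) / INR (S n) ^ k))
    (fun n => B * M n)).
  - apply ex_series_mult_l; auto.
  - generalize (filter_and _ _ HB Hloc). apply filter_imp.
    intros s [HBs [Hr [Hb HMs]]] n. split; [|apply Hmaj; auto].
    pose proof (INR_S_ge_1 n) as Hn.
    auto_derive.
    + split; [eexists; exact Hr|]. split; [eexists; apply c_derive|].
      split; [eexists; exact Hb|auto].
    + rewrite (Derive_eta _ _ _ Hr), (Derive_eta _ _ _ Hb), (Derive_eta _ _ _ (c_derive _)).
      change (match n with 0%nat => 1 | S _ => INR n + 1 end) with (INR (S n)).
      set (N := INR (S n)) in *. assert (HN : N <> 0) by lra.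
      pose proof (pow_nonzero N k HN). simpl pow. field. auto.
  - generalize Hloc. apply filter_imp. intros s [_ [_ HMs]]. apply Hex; auto.
Qed.

(** * The logarithm inside the unit disc *)

Lemma cos_bound (x : R) : Rabs (cos x) <= 1.
Proof. apply Rabs_le. pose proof (COS_bound x). lra. Qed.

Lemma sin_bound (x : R) : Rabs (sin x) <= 1.
Proof. apply Rabs_le. pose proof (SIN_bound x). lra. Qed.

Lemma opp_sin_bound (x : R) : Rabs (- sin x) <= 1.
Proof. rewrite Rabs_Ropp. apply sin_bound. Qed.

Lemma trigLi_opp_sin (k : nat) (r b : R) : trigLi (fun x => - sin x) k r b = - LiIm k r b.
Proof.
  unfold LiIm, trigLi. rewrite <- Series_opp. apply Series_ext. intros n.
  unfold Rdiv. ring.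
Qed.

Lemma Li_derive_open (k : nat) (r b lam bet : R -> R) (t : R) :
  Rabs (r t) < 1 -> continuous lam t -> continuous bet t ->
  locally t (fun s => is_derive r s (r s * lam s) /\ is_derive b s (bet s)) ->
  is_derive (fun s => LiRe (S k) (r s) (b s)) t
    (lam t * LiRe k (r t) (b t) - bet t * LiIm k (r t) (b t)) /\
  is_derive (fun s => LiIm (S k) (r s) (b s)) t
    (lam t * LiIm k (r t) (b t) + bet t * LiRe k (r t) (b t)).
Proof.
  intros Hr Hlam Hbet Hloc.
  set (q := (1 + Rabs (r t)) / 2).
  pose proof (Rabs_pos (r t)) as Hr0.
  assert (Hq : 0 <= q < 1) by (unfold q; lra).
  assert (HM : ex_series (fun n => q ^ S n)) by (apply ex_series_pow_S; rewrite Rabs_right; lra).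
  assert (Hmaj : locally t (fun s => is_derive r s (r s * lam s) /\ is_derive b s (bet s) /\
                      forall n, Rabs (r s ^ S n) <= q ^ S n * INR (S n) ^ k)).
  { assert (Hc : continuous r t).
    { apply (ex_derive_continuous r). eexists. exact (proj1 (locally_singleton _ _ Hloc)). }
    assert (He : 0 < q - Rabs (r t)) by (unfold q; lra).
    generalize (filter_and _ _ Hloc (proj1 (filterlim_locally _ _) Hc (mkposreal _ He))).
    apply filter_imp. intros s [[H1 H2] H3]. split; [exact H1|]. split; [exact H2|].
    intros n. apply open_disc_majorant.
    change (Rabs (r s - r t) < q - Rabs (r t)) in H3.
    pose proof (Rabs_triang_inv (r s) (r t)). lra. }
  split.
  - eapply is_derive_value.
    + apply (trigLi_derive cos cos_bound (fun x => - sin x) opp_sin_bound is_derive_cos _ k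
               r b lam bet t HM Hlam Hbet Hmaj).
    + rewrite trigLi_opp_sin. unfold LiRe. ring.
  - apply (trigLi_derive sin sin_bound cos cos_bound is_derive_sin _ k
               r b lam bet t HM Hlam Hbet Hmaj).
Qed.

Lemma Li_derive_circle (k : nat) (t : R) :
  (2 <= k)%nat ->
  is_derive (fun s => LiRe (S k) 1 s) t (- LiIm k 1 t) /\
  is_derive (fun s => LiIm (S k) 1 s) t (LiRe k 1 t).
Proof.
  intros Hk.
  assert (HM : ex_series (fun n => / INR (S n) ^ 2)) by (apply ex_series_inv_pow; lia).
  assert (Hmaj : locally t (fun s => is_derive (fun _ => 1) s (1 * 0) /\
                      is_derive (fun y : R => y) s 1 /\
                      forall n, Rabs (1 ^ S n) <= / INR (S n) ^ 2 * INR (S n) ^ k)).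
  { apply filter_forall. intros s. split; [|split].
    - rewrite Rmult_0_r. apply (is_derive_const 1).
    - apply (is_derive_id s).
    - intros n. apply closed_disc_majorant; auto. rewrite Rabs_R1; lra. }
  assert (H0 : continuous (fun _ : R => 0) t) by apply continuous_const.
  assert (H1 : continuous (fun _ : R => 1) t) by apply continuous_const.
  split; eapply is_derive_value.
  - apply (trigLi_derive cos cos_bound (fun x => - sin x) opp_sin_bound is_derive_cos _ k
             (fun _ => 1) (fun y => y) (fun _ => 0) (fun _ => 1) t HM H0 H1 Hmaj).
  - rewrite trigLi_opp_sin. ring.
  - apply (trigLi_derive sin sin_bound cos cos_bound is_derive_sin _ k
             (fun _ => 1) (fun y => y) (fun _ => 0) (fun _ => 1) t HM H0 H1 Hmaj).
  - unfold LiRe. ring.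
Qed.

Lemma one_sub_polar_pos (r b : R) : 0 <= r < 1 -> 0 < 1 - 2 * r * cos b + r ^ 2.
Proof. intros Hr. pose proof (COS_bound b). nra. Qed.

(** Shifting the geometric series by one term says that X = z (1 + X); its real and imaginary
    parts form a linear system. *)
Lemma Li_0 (r b : R) :
  0 <= r < 1 ->
  LiRe 0 r b = (r * cos b - r ^ 2) / (1 - 2 * r * cos b + r ^ 2) /\
  LiIm 0 r b = r * sin b / (1 - 2 * r * cos b + r ^ 2).
Proof.
  intros Hr. assert (Hr1 : Rabs r < 1) by (rewrite Rabs_right; lra).
  pose proof (one_sub_polar_pos r b Hr) as Hd.
  pose proof (ex_trigLi_open cos cos_bound 0 r b Hr1) as Hc.
  pose proof (ex_trigLi_open sin sin_bound 0 r b Hr1) as Hs.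
  assert (Hx : LiRe 0 r b = r * cos b * (1 + LiRe 0 r b) - r * sin b * LiIm 0 r b).
  { unfold LiRe at 1, trigLi. rewrite (Series_incr_1 _ Hc).
    rewrite (Series_ext _ (fun n => r * cos b * (r ^ S n * cos (INR (S n) * b) / INR (S n) ^ 0)
                                  - r * sin b * (r ^ S n * sin (INR (S n) * b) / INR (S n) ^ 0))).
    - rewrite Series_minus, !Series_scal_l by (apply ex_series_mult_l; assumption).
      fold (trigLi cos 0 r b) (trigLi sin 0 r b). unfold LiRe, LiIm.
      simpl. rewrite Rmult_1_l. field.
    - intros n. rewrite (S_INR (S n)), Rmult_plus_distr_r, Rmult_1_l, cos_plus.
      simpl pow. field. }
  assert (Hy : LiIm 0 r b = r * sin b * (1 + LiRe 0 r b) + r * cos b * LiIm 0 r b).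
  { unfold LiIm at 1, trigLi. rewrite (Series_incr_1 _ Hs).
    rewrite (Series_ext _ (fun n => r * sin b * (r ^ S n * cos (INR (S n) * b) / INR (S n) ^ 0)
                                  + r * cos b * (r ^ S n * sin (INR (S n) * b) / INR (S n) ^ 0))).
    - rewrite Series_plus, !Series_scal_l by (apply ex_series_mult_l; assumption).
      fold (trigLi cos 0 r b) (trigLi sin 0 r b). unfold LiRe, LiIm.
      simpl. rewrite Rmult_1_l. field.
    - intros n. rewrite (S_INR (S n)), Rmult_plus_distr_r, Rmult_1_l, sin_plus.
      simpl pow. field. }
  assert (Hcs : sin b ^ 2 = 1 - cos b ^ 2) by (pose proof (sin2_cos2 b); unfold Rsqr in *; lra).
  set (X := LiRe 0 r b) in *. set (Y := LiIm 0 r b) in *.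
  (* The determinant of this linear system in X, Y is the squared modulus of 1 - z. *)
  split.
  - assert (E : X * (1 - 2 * r * cos b + r ^ 2) = r * cos b - r ^ 2).
    { assert (E : (1 - r * cos b) * (X - (r * cos b * (1 + X) - r * sin b * Y))
               - r * sin b * (Y - (r * sin b * (1 + X) + r * cos b * Y)) = 0)
        by (rewrite <- Hx, <- Hy; ring).
      ring_simplify in E. rewrite Hcs in E. ring_simplify in E. lra. }
    rewrite <- E. field. lra.
  - assert (E : Y * (1 - 2 * r * cos b + r ^ 2) = r * sin b).
    { assert (E : (1 - r * cos b) * (Y - (r * sin b * (1 + X) + r * cos b * Y))
               + r * sin b * (X - (r * cos b * (1 + X) - r * sin b * Y)) = 0)
        by (rewrite <- Hx, <- Hy; ring).
      ring_simplify in E. rewrite Hcs in E. ring_simplify in E. lra. }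
    rewrite <- E. field. lra.
Qed.

Lemma Li_at_0 (c : R -> R) (k : nat) (b : R) : trigLi c k 0 b = 0.
Proof.
  unfold trigLi. rewrite (Series_ext _ (fun n => 0 * 0)).
  - rewrite Series_scal_l. ring.
  - intros n. simpl pow. unfold Rdiv. ring.
Qed.

(** Both sides are real and imaginary parts of -ln(1 - z).  They agree at the origin and have
    the same derivative along the radius, by the closed form of the geometric series. *)
Lemma Li_1 (r b : R) :
  0 < r < 1 ->
  LiRe 1 r b = - (ln (1 - 2 * r * cos b + r ^ 2) / 2) /\
  LiIm 1 r b = atan (r * sin b / (1 - r * cos b)).
Proof.
  intros Hr.
  assert (Hd : forall t, 0 < t < 1 ->
    is_derive (fun s => LiRe 1 s b) t ((cos b - t) / (1 - 2 * t * cos b + t ^ 2)) /\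
    is_derive (fun s => LiIm 1 s b) t (sin b / (1 - 2 * t * cos b + t ^ 2))).
  { intros t Ht.
    destruct (Li_derive_open 0 (fun s => s) (fun _ => b) (fun s => / s) (fun _ => 0) t) as [H1 H2].
    - rewrite Rabs_right; lra.
    - apply (ex_derive_continuous (fun s => / s)). auto_derive. lra.
    - apply continuous_const.
    - assert (Hp : 0 < t) by lra. exists (mkposreal _ Hp). intros s Hs.
      change (Rabs (s - t) < t) in Hs. apply Rabs_def2 in Hs. split.
      + rewrite Rinv_r by lra. apply (is_derive_id s).
      + apply (is_derive_const b).
    - destruct (Li_0 t b) as [E1 E2]; [lra|]. rewrite E1, E2 in H1, H2.
      pose proof (one_sub_polar_pos t b ltac:(lra)).
      split; [eapply is_derive_value; [exact H1|field; lra]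
             |eapply is_derive_value; [exact H2|field; lra]]. }
  assert (Hlim : forall c : R -> R, (forall x, Rabs (c x) <= 1) -> (forall x, continuous c x) ->
            filterlim (fun s => trigLi c 1 s b) (at_right 0) (locally 0)).
  { intros c Hc Hcc. replace (locally 0) with (locally (trigLi c 1 0 b)) by now rewrite Li_at_0.
    apply (trigLi_limit_open c Hc Hcc (at_right 0) (1 / 2)).
    - lra.
    - generalize (at_right_lt 0 (1 / 2) ltac:(lra)). apply filter_imp.
      intros x Hx. rewrite Rabs_right; lra.
    - apply filterlim_id_at_right.
    - apply filterlim_const. }
  split.
  - assert (E : LiRe 1 r b + ln (1 - 2 * r * cos b + r ^ 2) / 2 = 0); [|lra].
    apply (derivative_zero_limit (fun s => LiRe 1 s b + ln (1 - 2 * s * cos b + s ^ 2) / 2)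
             0 1 0); auto.
    + intros t Ht. destruct (Hd t Ht) as [H _].
      pose proof (one_sub_polar_pos t b ltac:(lra)).
      eapply is_derive_value.
      * apply (is_derive_plus (fun s => LiRe 1 s b)); [exact H|].
        apply (is_derive_Reals (fun s => ln (1 - 2 * s * cos b + s ^ 2) / 2)).
        apply is_derive_Reals. auto_derive; [simpl in *; lra|reflexivity].
      * unfold plus; simpl. field. simpl in *; lra.
    + replace (locally 0) with (locally (0 + ln (1 - 2 * 0 * cos b + 0 ^ 2) / 2))
        by (f_equal; replace (1 - 2 * 0 * cos b + 0 ^ 2) with 1 by ring; rewrite ln_1; field).
      apply (filterlim_Rplus (at_right 0)); [apply (Hlim cos cos_bound continuous_cos)|].
      apply (continuous_at_right (fun s => ln (1 - 2 * s * cos b + s ^ 2) / 2)).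
      apply (ex_derive_continuous (fun s => ln (1 - 2 * s * cos b + s ^ 2) / 2)).
      auto_derive. lra.
  - assert (E : LiIm 1 r b - atan (r * sin b / (1 - r * cos b)) = 0); [|lra].
    apply (derivative_zero_limit (fun s => LiIm 1 s b - atan (s * sin b / (1 - s * cos b)))
             0 1 0); auto.
    + intros t Ht. destruct (Hd t Ht) as [_ H].
      pose proof (one_sub_polar_pos t b ltac:(lra)) as Hp.
      assert (Hq : 1 - t * cos b > 0) by (pose proof (COS_bound b); nra).
      assert (Hcs : sin b ^ 2 = 1 - cos b ^ 2)
        by (pose proof (sin2_cos2 b); unfold Rsqr in *; lra).
      assert (E : (1 - t * cos b) ^ 2 + (t * sin b) ^ 2 = 1 - 2 * t * cos b + t ^ 2)
        by (rewrite Rpow_mult_distr, Hcs; ring).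
      assert (Ha : is_derive (fun s => atan (s * sin b / (1 - s * cos b))) t
                     (sin b / (1 - 2 * t * cos b + t ^ 2))).
      { rewrite <- E. auto_derive; [lra|]. field.
        split; [lra|]. rewrite <- E in Hp. simpl in *. lra. }
      eapply is_derive_value.
      * exact (is_derive_minus (fun s => LiIm 1 s b) _ t _ _ H Ha).
      * unfold minus, plus, opp; simpl. ring.
    + replace (locally 0) with (locally (0 - atan (0 * sin b / (1 - 0 * cos b))))
        by (f_equal; replace (0 * sin b / (1 - 0 * cos b)) with 0 by (field; lra);
            rewrite atan_0; ring).
      apply (filterlim_Rminus (at_right 0)); [apply (Hlim sin sin_bound continuous_sin)|].
      apply (continuous_at_right (fun s => atan (s * sin b / (1 - s * cos b)))).
      apply (ex_derive_continuous (fun s => atan (s * sin b / (1 - s * cos b)))).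
      auto_derive. lra.
Qed.

(** * The dilogarithm on the unit circle *)

Lemma atan_lipschitz (x y : R) : Rabs (atan x - atan y) <= Rabs (x - y).
Proof.
  destruct (MVT_gen atan y x (fun z => / (1 + z ^ 2))) as [c [_ Hc]].
  - intros z _. auto_derive; auto. field. nra.
  - intros z _. apply derivable_continuous_pt, derivable_pt_atan.
  - rewrite Hc, Rabs_mult. rewrite <- (Rmult_1_l (Rabs (x - y))) at 2.
    apply Rmult_le_compat_r; [apply Rabs_pos|].
    rewrite Rabs_right by (apply Rle_ge, Rlt_le, Rinv_0_lt_compat; nra).
    rewrite <- Rinv_1 at 2. apply Rinv_le_contravar; nra.
Qed.

Lemma ln_lipschitz (m x y : R) :
  0 < m -> m <= x -> m <= y -> Rabs (ln x - ln y) <= Rabs (x - y) / m.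
Proof.
  intros Hm Hx Hy.
  assert (Hb : forall z, Rmin y x <= z <= Rmax y x -> m <= z).
  { intros z Hz. eapply Rle_trans; [|apply Hz]. now apply Rmin_glb. }
  destruct (MVT_gen ln y x (fun z => / z)) as [c [Hc1 Hc]].
  - intros z Hz. assert (m <= z) by (apply Hb; lra). auto_derive; [lra|]. field. lra.
  - intros z Hz. apply continuity_pt_filterlim, (ex_derive_continuous ln).
    specialize (Hb z Hz). auto_derive. lra.
  - specialize (Hb c Hc1). rewrite Hc, Rabs_mult, Rmult_comm. unfold Rdiv.
    apply Rmult_le_compat_l; [apply Rabs_pos|].
    rewrite Rabs_right by (apply Rle_ge, Rlt_le, Rinv_0_lt_compat; lra).
    apply Rinv_le_contravar; lra.
Qed.

(** A sequence of radii in [1/2, 1) tending to 1, for Abel summation. *)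
Definition abel_radius (n : nat) : R := 1 - / INR (n + 2).

Lemma abel_radius_bounds (n : nat) : 1 / 2 <= abel_radius n < 1.
Proof.
  unfold abel_radius. rewrite plus_INR. simpl. pose proof (pos_INR n).
  assert (/ (INR n + (1 + 1)) <= / 2) by (apply Rinv_le_contravar; lra).
  assert (0 < / (INR n + (1 + 1))) by (apply Rinv_0_lt_compat; lra). lra.
Qed.

Lemma abel_radius_cv (eps : R) :
  0 < eps -> exists N, forall n, (N <= n)%nat -> 1 - abel_radius n < eps.
Proof.
  intros Heps. destruct (archimed_cor1 eps Heps) as [N [HN HN0]].
  exists N. intros n Hn. unfold abel_radius. ring_simplify.
  eapply Rle_lt_trans; [|exact HN]. apply Rinv_le_contravar.
  - apply lt_0_INR; lia.
  - apply le_INR; lia.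
Qed.

Lemma filterlim_abel_radius : filterlim abel_radius eventually (locally 1).
Proof.
  apply filterlim_locally. intros eps.
  destruct (abel_radius_cv eps (cond_pos eps)) as [N HN].
  exists N. intros n Hn. specialize (HN n Hn). pose proof (abel_radius_bounds n).
  change (Rabs (abel_radius n - 1) < eps). rewrite Rabs_left; lra.
Qed.

(** Differentiation of a radial limit when the derivatives converge uniformly, at rate 1 - r. *)
Lemma abel_derive (f : R -> R -> R) (g : R -> R) (K t : R) (d : posreal) :
  (forall r y, 1 / 2 <= r < 1 -> Boule t d y -> exists l,
      is_derive (f r) y l /\ Rabs (l - g y) <= K * (1 - r)) ->
  (forall y, Boule t d y -> filterlim (fun n => f (abel_radius n) y) eventually (locally (f 1 y))) ->
  (forall y, Boule t d y -> continuous g y) ->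
  is_derive (f 1) t (g t).
Proof.
  intros Hd Hlim Hg. apply is_derive_Reals.
  apply (derivable_pt_lim_CVU (fun n => f (abel_radius n))
           (fun n y => Derive (f (abel_radius n)) y) (f 1) g t t d).
  - unfold Boule. rewrite Rminus_diag_eq, Rabs_R0 by auto. apply cond_pos.
  - intros y n Hy. apply is_derive_Reals, Derive_correct.
    destruct (Hd _ y (abel_radius_bounds n) Hy) as [l [Hl _]]. now exists l.
  - intros y Hy. apply is_lim_seq_Reals, Hlim, Hy.
  - intros eps Heps.
    assert (HK : 0 < eps / (Rabs K + 1)).
    { apply Rdiv_lt_0_compat; auto. pose proof (Rabs_pos K); lra. }
    destruct (abel_radius_cv _ HK) as [N HN]. exists N. intros n y Hn Hy.
    destruct (Hd _ y (abel_radius_bounds n) Hy) as [l [Hl Hle]].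
    rewrite (is_derive_unique _ _ _ Hl), Rabs_minus_sym.
    eapply Rle_lt_trans; [exact Hle|].
    specialize (HN n Hn). pose proof (abel_radius_bounds n). pose proof (Rabs_pos K).
    apply Rle_lt_trans with ((Rabs K + 1) * (1 - abel_radius n)).
    + apply Rmult_le_compat_r; [lra|]. pose proof (Rle_abs K); lra.
    + replace eps with ((Rabs K + 1) * (eps / (Rabs K + 1))) by (field; lra).
      apply Rmult_lt_compat_l; lra.
  - intros y Hy. apply continuity_pt_filterlim, Hg, Hy.
Qed.

(** On the unit circle the differentiated series converges only conditionally, so termwise
    differentiation is not available.  Inside the disc the derivative is given by the closed
    form of Li_1, which is uniformly close to its boundary value while cos t stays away
    from 1. *)
Lemma Li_2_derive_circle (t : R) :
  cos t < 1 ->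
  is_derive (fun s => LiIm 2 1 s) t (- (ln (2 - 2 * cos t) / 2)) /\
  is_derive (fun s => LiRe 2 1 s) t (- atan (sin t / (1 - cos t))).
Proof.
  intros Hcos.
  set (m := (1 - cos t) / 2). assert (Hm : 0 < m) by (unfold m; lra).
  destruct (proj1 (filterlim_locally _ _) (continuous_cos t) (mkposreal _ Hm)) as [d Hd].
  assert (Hy : forall y, Boule t d y -> m < 1 - cos y).
  { intros y Hy. specialize (Hd y Hy). change (Rabs (cos y - cos t) < m) in Hd.
    apply Rabs_def2 in Hd. unfold m in *. lra. }
  assert (Hder : forall r y, 1 / 2 <= r < 1 ->
     is_derive (fun s => LiRe 2 r s) y (- atan (r * sin y / (1 - r * cos y))) /\
     is_derive (fun s => LiIm 2 r s) y (- (ln (1 - 2 * r * cos y + r ^ 2) / 2))).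
  { intros r y Hr. destruct (Li_1 r y) as [E1 E2]; [lra|]. rewrite <- E1, <- E2.
    destruct (Li_derive_open 1 (fun _ => r) (fun s => s) (fun _ => 0) (fun _ => 1) y) as [H1 H2].
    - rewrite Rabs_right; lra.
    - apply continuous_const.
    - apply continuous_const.
    - apply filter_forall. intros s. split.
      + rewrite Rmult_0_r. apply (is_derive_const r).
      + apply (is_derive_id s).
    - split; eapply is_derive_value; try eassumption; ring. }
  assert (Hlim : forall c : R -> R, (forall x, Rabs (c x) <= 1) -> (forall x, continuous c x) ->
    forall y, filterlim (fun n => trigLi c 2 (abel_radius n) y) eventually
                (locally (trigLi c 2 1 y))).
  { intros c Hc Hcc y. apply (trigLi_limit_closed c Hc Hcc eventually); auto.
    - exists 0%nat. intros n _. pose proof (abel_radius_bounds n). rewrite Rabs_right; lra.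
    - apply filterlim_abel_radius.
    - apply filterlim_const. }
  split.
  - apply (abel_derive (fun r s => LiIm 2 r s) (fun s => - (ln (2 - 2 * cos s) / 2)) (5 / m) t d).
    + intros r y Hr HB. specialize (Hy y HB).
      eexists; split; [exact (proj2 (Hder r y Hr))|].
      replace (- (ln (1 - 2 * r * cos y + r ^ 2) / 2) - - (ln (2 - 2 * cos y) / 2))
        with (- ((ln (1 - 2 * r * cos y + r ^ 2) - ln (2 - 2 * cos y)) / 2)) by field.
      pose proof (COS_bound y) as Hcb.
      assert (HL : Rabs (ln (1 - 2 * r * cos y + r ^ 2) - ln (2 - 2 * cos y))
                   <= Rabs (1 - 2 * r * cos y + r ^ 2 - (2 - 2 * cos y)) / m)
        by (apply ln_lipschitz; nra).
      assert (HA : Rabs (1 - 2 * r * cos y + r ^ 2 - (2 - 2 * cos y)) <= 5 * (1 - r)).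
      { replace (1 - 2 * r * cos y + r ^ 2 - (2 - 2 * cos y))
          with ((1 - r) * (2 * cos y - 1 - r)) by ring.
        rewrite Rabs_mult, (Rabs_right (1 - r)), Rmult_comm by lra.
        apply Rmult_le_compat_r; [lra|]. apply Rabs_le. lra. }
      rewrite Rabs_Ropp. unfold Rdiv at 1. rewrite Rabs_mult, (Rabs_right (/ 2)) by lra.
      replace (5 / m * (1 - r)) with (5 * (1 - r) / m) by (field; lra).
      assert (Rabs (1 - 2 * r * cos y + r ^ 2 - (2 - 2 * cos y)) / m <= 5 * (1 - r) / m)
        by (apply Rmult_le_compat_r; [apply Rlt_le, Rinv_0_lt_compat|]; lra).
      pose proof (Rabs_pos (ln (1 - 2 * r * cos y + r ^ 2) - ln (2 - 2 * cos y))). lra.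
    + intros y _. apply (Hlim sin sin_bound continuous_sin).
    + intros y HB. specialize (Hy y HB).
      apply (ex_derive_continuous (fun s => - (ln (2 - 2 * cos s) / 2))).
      auto_derive. lra.
  - apply (abel_derive (fun r s => LiRe 2 r s) (fun s => - atan (sin s / (1 - cos s)))
             (/ m ^ 2) t d).
    + intros r y Hr HB. specialize (Hy y HB).
      eexists; split; [exact (proj1 (Hder r y Hr))|].
      pose proof (COS_bound y) as Hcb. pose proof (SIN_bound y) as Hsb.
      assert (Hr' : m <= 1 - r * cos y).
      { destruct (Rle_dec 0 (cos y)); [nra|].
        pose proof (COS_bound t). unfold m. nra. }
      rewrite <- Rabs_Ropp.
      replace (- (- atan (r * sin y / (1 - r * cos y)) - - atan (sin y / (1 - cos y))))
        with (atan (r * sin y / (1 - r * cos y)) - atan (sin y / (1 - cos y))) by ring.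
      eapply Rle_trans; [apply atan_lipschitz|].
      replace (r * sin y / (1 - r * cos y) - sin y / (1 - cos y))
        with (- ((1 - r) * sin y * / ((1 - r * cos y) * (1 - cos y)))) by (field; lra).
      assert (Hmm : m ^ 2 <= (1 - r * cos y) * (1 - cos y)).
      { simpl. rewrite Rmult_1_r. apply Rmult_le_compat; lra. }
      assert (Hm2 : 0 < m ^ 2) by nra.
      rewrite Rabs_Ropp, !Rabs_mult, (Rabs_right (1 - r)), (Rabs_right (/ _)) by
        (try lra; apply Rle_ge, Rlt_le, Rinv_0_lt_compat; lra).
      rewrite (Rmult_comm (/ m ^ 2)). apply Rmult_le_compat.
      * apply Rmult_le_pos; [lra|apply Rabs_pos].
      * apply Rlt_le, Rinv_0_lt_compat; lra.
      * rewrite <- (Rmult_1_r (1 - r)) at 2. apply Rmult_le_compat_l; [lra|apply sin_bound].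
      * apply Rinv_le_contravar; lra.
    + intros y _. apply (Hlim cos cos_bound continuous_cos).
    + intros y HB. specialize (Hy y HB).
      apply (ex_derive_continuous (fun s => - atan (sin s / (1 - cos s)))).
      auto_derive. lra.
Qed.

(** * Central binomial series along a chord *)

Lemma central_binom_0 : central_binom 0 = 1.
Proof. unfold central_binom, Binomial.C. simpl. field. Qed.

Lemma central_binom_S (n : nat) :
  central_binom (S n) = central_binom n * (2 * (2 * INR n + 1)) / INR (S n).
Proof.
  unfold central_binom, Binomial.C.
  replace (2 * S n - S n)%nat with (S n) by lia.
  replace (2 * n - n)%nat with n by lia.
  replace (2 * S n)%nat with (S (S (2 * n))) by lia.
  rewrite !fact_simpl, !mult_INR, !S_INR, mult_INR. simpl (INR 2).
  pose proof (INR_fact_neq_0 n). pose proof (pos_INR n). field. split; [auto|lra].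
Qed.

(** Consecutive central binomial coefficients have ratio at least 2. *)
Lemma central_binom_ge (n : nat) : 2 ^ n <= central_binom n.
Proof.
  induction n as [|n IH].
  - rewrite central_binom_0. simpl. lra.
  - rewrite central_binom_S. pose proof (INR_S_ge_1 n) as Hn. pose proof (pos_INR n).
    assert (0 < 2 ^ n) by (apply pow_lt; lra).
    apply Rmult_le_reg_r with (INR (S n)); [lra|].
    unfold Rdiv. rewrite (Rmult_assoc _ (/ _)), Rinv_l, Rmult_1_r by lra.
    rewrite S_INR in *. simpl. nra.
Qed.

Lemma central_binom_pos (n : nat) : 0 < central_binom n.
Proof.
  eapply Rlt_le_trans; [|apply central_binom_ge]. apply pow_lt; lra.
Qed.

(** The recurrence (4n + 2) binom(2n,n) = (n+1) binom(2n+2,n+1) in the linear form that yields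
    an equation between the series of exponents 0 and 1. *)
Lemma inv_central_binom_S (n : nat) :
  4 / central_binom (S n) - 2 / (INR (S n) * central_binom (S n)) = / central_binom n.
Proof.
  rewrite central_binom_S. pose proof (central_binom_pos n). pose proof (pos_INR n).
  rewrite !S_INR. field. repeat split; lra.
Qed.

Lemma inv_central_binom_le (n : nat) : 0 < / central_binom n <= (1 / 2) ^ n.
Proof.
  split; [apply Rinv_0_lt_compat, central_binom_pos|].
  unfold Rdiv. rewrite Rmult_1_l, pow_inv. apply Rinv_le_contravar.
  - apply pow_lt; lra.
  - apply central_binom_ge.
Qed.

(** The sum over n >= 1 of y^n / (n^k binom(2n,n)); the theorem is about the value at k = 5,
    y = 1. *)
Definition cbSeries (k : nat) (y : R) : R :=
  Series (fun n => y ^ S n / (INR (S n) ^ k * central_binom (S n))).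

Lemma ex_series_half : ex_series (fun n => (1 / 2) ^ S n).
Proof. apply ex_series_pow_S. rewrite Rabs_right; lra. Qed.

Lemma cbSeries_term_bound (k n : nat) (z m : R) :
  Rabs z <= m -> Rabs (z / (INR (S n) ^ k * central_binom (S n))) <= m * (1 / 2) ^ S n.
Proof.
  intros Hz. pose proof (INR_S_pow_ge_1 n k) as Hp. pose proof (central_binom_pos (S n)) as Hb.
  pose proof (inv_central_binom_le (S n)) as Hi.
  unfold Rdiv at 1. rewrite Rabs_mult. apply Rmult_le_compat; auto using Rabs_pos.
  rewrite Rinv_mult, Rabs_right.
  - eapply Rle_trans; [|apply Hi].
    rewrite <- (Rmult_1_l (/ central_binom (S n))) at 2.
    apply Rmult_le_compat_r; [lra|]. rewrite <- Rinv_1. apply Rinv_le_contravar; lra.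
  - apply Rle_ge, Rmult_le_pos; [apply Rlt_le, Rinv_0_lt_compat|]; lra.
Qed.

Lemma pow_le_1 (y : R) (n : nat) : 0 <= y <= 1 -> y ^ n <= 1.
Proof. intros Hy. rewrite <- (pow1 n). apply pow_incr, Hy. Qed.

Lemma ex_cbSeries (k : nat) (y : R) :
  0 <= y <= 1 -> ex_series (fun n => y ^ S n / (INR (S n) ^ k * central_binom (S n))).
Proof.
  intros Hy. apply ex_series_dominated with (fun n => 1 * (1 / 2) ^ S n).
  - apply ex_series_mult_l, ex_series_half.
  - intros n. apply cbSeries_term_bound.
    rewrite Rabs_right by (apply Rle_ge, pow_le; lra). now apply pow_le_1.
Qed.

Lemma cbSeries_bound (k : nat) (y : R) :
  0 <= y <= 1 -> Rabs (cbSeries k y) <= y * Series (fun n => (1 / 2) ^ S n).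
Proof.
  intros Hy. rewrite <- Series_scal_l. apply Series_dominated.
  - apply ex_series_mult_l, ex_series_half.
  - intros n. apply cbSeries_term_bound.
    rewrite Rabs_right by (apply Rle_ge, pow_le; lra). simpl.
    rewrite <- (Rmult_1_r y) at 3. apply Rmult_le_compat_l; [lra|]. now apply pow_le_1.
Qed.

Lemma cbSeries_limit {T} (F : (T -> Prop) -> Prop) {FF : ProperFilter F}
  (k : nat) (y : T -> R) (y0 : R) :
  F (fun x => 0 <= y x <= 1) -> filterlim y F (locally y0) ->
  filterlim (fun x => cbSeries k (y x)) F (locally (cbSeries k y0)).
Proof.
  intros HF Hy.
  apply (tannery F (fun n x => y x ^ S n / (INR (S n) ^ k * central_binom (S n)))
           (fun n => y0 ^ S n / (INR (S n) ^ k * central_binom (S n))) (fun n => 1 * (1 / 2) ^ S n)).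
  - apply ex_series_mult_l, ex_series_half.
  - generalize HF. apply filter_imp. intros x Hx n. apply cbSeries_term_bound.
    rewrite Rabs_right by (apply Rle_ge, pow_le; lra). now apply pow_le_1.
  - intros n. apply (filterlim_Rmult F); [|apply filterlim_const].
    apply (filterlim_comp _ _ _ y (fun z => z ^ S n) F (locally y0)); [exact Hy|].
    apply (ex_derive_continuous (fun z => z ^ S n)). auto_derive. auto.
Qed.

Lemma cbSeries_0_1 (y : R) :
  0 <= y <= 1 -> (4 - y) * cbSeries 0 y = 2 * cbSeries 1 y + y.
Proof.
  intros Hy.
  assert (E : 4 * cbSeries 0 y - 2 * cbSeries 1 y = y * Series (fun n => y ^ n / central_binom n)).
  { unfold cbSeries. rewrite <- !Series_scal_l, <- Series_minus
      by (apply ex_series_mult_l, ex_cbSeries, Hy).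
    apply Series_ext. intros n. unfold Rdiv. rewrite <- (inv_central_binom_S n).
    pose proof (INR_S_ge_1 n). pose proof (central_binom_pos (S n)).
    set (N := INR (S n)) in *. simpl pow. field. lra. }
  rewrite Series_incr_1 in E.
  - rewrite central_binom_0 in E. unfold cbSeries in *.
    rewrite (Series_ext (fun k => y ^ S k / central_binom (S k))
               (fun n => y ^ S n / (INR (S n) ^ 0 * central_binom (S n)))) in E.
    + replace (y ^ 0 / 1) with 1 in E by (simpl; field). lra.
    + intros n. simpl. rewrite Rmult_1_l. reflexivity.
  - apply ex_series_incr_1.
    eapply ex_series_ext; [|apply (ex_cbSeries 0 y Hy)].
    intros n. simpl. rewrite Rmult_1_l. reflexivity.
Qed.

Lemma PI_3_pos : 0 < PI / 3.
Proof. pose proof PI_RGT_0. lra. Qed.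

(** The length |1 - e^(it)|, for t in [0, pi]. *)
Definition chord (t : R) : R := 2 * sin (t / 2).

Lemma chord_bounds (t : R) : 0 < t < PI / 3 -> 0 < chord t < 1.
Proof.
  intros Ht. pose proof PI_RGT_0. unfold chord. split.
  - pose proof (sin_gt_0 (t / 2)). lra.
  - pose proof (sin_increasing_1 (t / 2) (PI / 6)). rewrite sin_PI6 in *. lra.
Qed.

Lemma cbSeries_chord_bound (k : nat) (t : R) :
  0 < t < PI / 3 ->
  Rabs (cbSeries k (chord t ^ 2)) <= Series (fun n => (1 / 2) ^ S n) * chord t.
Proof.
  intros Ht. pose proof (chord_bounds t Ht) as Hc.
  pose proof (cbSeries_bound k (chord t ^ 2) ltac:(nra)) as HB.
  set (K := Series _) in *.
  assert (0 <= K).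
  { apply Rmult_le_reg_l with (chord t ^ 2); [nra|]. rewrite Rmult_0_r.
    eapply Rle_trans; [apply Rabs_pos|exact HB]. }
  eapply Rle_trans; [exact HB|]. rewrite Rmult_comm. apply Rmult_le_compat_l; nra.
Qed.

Lemma cos_half_pos (t : R) : 0 < t < PI / 3 -> 0 < cos (t / 2).
Proof. intros Ht. apply cos_gt_0; lra. Qed.

Lemma cbSeries_chord_derive (k : nat) (t : R) :
  0 < t < PI / 3 ->
  is_derive (fun s => cbSeries (S k) (chord s ^ 2)) t
    (cos (t / 2) / sin (t / 2) * cbSeries k (chord t ^ 2)).
Proof.
  intros Ht. unfold cbSeries at 2. rewrite <- Series_scal_l.
  apply (is_derive_Series
    (fun n s => (chord s ^ 2) ^ S n / (INR (S n) ^ S k * central_binom (S n)))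
    (fun n s => cos (s / 2) / sin (s / 2)
                * ((chord s ^ 2) ^ S n / (INR (S n) ^ k * central_binom (S n))))
    (fun n => 2 * (1 / 2) ^ S n)).
  - apply ex_series_mult_l, ex_series_half.
  - apply (locally_interval 0 (PI / 3)); auto. intros s Hs n.
    pose proof (chord_bounds s Hs) as Hc. pose proof (INR_S_ge_1 n) as Hn.
    pose proof (central_binom_pos (S n)) as Hb.
    assert (Hsin : 0 < sin (s / 2)) by (unfold chord in Hc; lra).
    split.
    + unfold chord. auto_derive; [auto|].
      change (match n with 0%nat => 1 | S _ => INR n + 1 end) with (INR (S n)).
      set (N := INR (S n)) in *. assert (HN : N <> 0) by lra.
      pose proof (pow_nonzero N k HN). change (s * / 2) with (s / 2). simpl pow.
      set (Q := (_ * _) ^ n). field. repeat split; lra.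
    + replace (cos (s / 2) / sin (s / 2)
                * ((chord s ^ 2) ^ S n / (INR (S n) ^ k * central_binom (S n))))
        with (2 * cos (s / 2) * chord s * (chord s ^ 2) ^ n
              / (INR (S n) ^ k * central_binom (S n))).
      * apply cbSeries_term_bound.
        assert (Hy : 0 <= chord s ^ 2 <= 1) by nra.
        rewrite !Rabs_mult, (Rabs_right 2), (Rabs_right (chord s)),
          (Rabs_right (_ ^ n)) by (try lra; apply Rle_ge, pow_le; lra).
        pose proof (pow_le_1 _ n Hy). pose proof (pow_le _ n (proj1 Hy)).
        pose proof (cos_bound (s / 2)). pose proof (Rabs_pos (cos (s / 2))).
        apply Rle_trans with (2 * 1 * 1 * 1); [|lra].
        repeat apply Rmult_le_compat; try lra.
        apply Rmult_le_pos; lra.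
      * unfold chord. assert (HN : INR (S n) <> 0) by lra.
        pose proof (pow_nonzero _ k HN). set (N := INR (S n)) in *.
        simpl pow. set (Q := (_ * _) ^ n). field. repeat split; lra.
  - apply (locally_interval 0 (PI / 3)); auto. intros s Hs.
    pose proof (chord_bounds s Hs) as Hc. apply ex_cbSeries. nra.
Qed.

Lemma filterlim_chord_0 : filterlim chord (at_right 0) (locally 0).
Proof.
  replace (locally 0) with (locally (chord 0))
    by (unfold chord; now rewrite Rdiv_0_l, sin_0, Rmult_0_r).
  apply continuous_at_right, (ex_derive_continuous chord). unfold chord. auto_derive. auto.
Qed.

(** With y = 4 sin^2(t/2), the relation [cbSeries_0_1] becomes a first-order linear
    differential equation in t whose solution vanishing at 0 is t tan(t/2). *)
Lemma cbSeries_1_chord (t : R) :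
  0 < t < PI / 3 -> cbSeries 1 (chord t ^ 2) * (cos (t / 2) / sin (t / 2)) = t.
Proof.
  intros Ht.
  set (K := Series (fun n => (1 / 2) ^ S n)).
  assert (E : cbSeries 1 (chord t ^ 2) * (cos (t / 2) / sin (t / 2)) - t = 0); [|lra].
  apply (derivative_zero_limit
    (fun s => cbSeries 1 (chord s ^ 2) * (cos (s / 2) / sin (s / 2)) - s) 0 (PI / 3) 0); auto.
  - intros s Hs. pose proof (chord_bounds s Hs) as Hc.
    assert (Hsin : 0 < sin (s / 2)) by (unfold chord in Hc; lra).
    pose proof (cbSeries_chord_derive 0 s Hs) as HP.
    assert (Hode : (4 - chord s ^ 2) * cbSeries 0 (chord s ^ 2)
                   = 2 * cbSeries 1 (chord s ^ 2) + chord s ^ 2)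
      by (apply cbSeries_0_1; nra).
    assert (Hgen : forall (p : R -> R) (l : R), is_derive p s l ->
      is_derive (fun u => p u * (cos (u / 2) / sin (u / 2)) - u) s
        (l * (cos (s / 2) / sin (s / 2))
         - p s * ((cos (s / 2) * cos (s / 2) + sin (s / 2) * sin (s / 2))
                  / (2 * (sin (s / 2) * sin (s / 2)))) - 1)).
    { intros p l Hp. auto_derive; [split; [now exists l|split; [lra|auto]]|].
      rewrite (Derive_eta _ _ _ Hp). change (s * / 2) with (s / 2). field. lra. }
    eapply is_derive_value; [exact (Hgen _ _ HP)|]. clear Hgen HP.
    pose proof (sin2_cos2 (s / 2)) as H1. unfold Rsqr in H1. unfold chord in *.
    set (si := sin (s / 2)) in *. set (co := cos (s / 2)) in *.
    set (Z := cbSeries 0 ((2 * si) ^ 2)) in *. set (p := cbSeries 1 ((2 * si) ^ 2)) in *.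
    assert (HZ : Z * (co * co) = p / 2 + si * si).
    { replace (co * co) with ((4 - (2 * si) ^ 2) / 4) by lra.
      replace (Z * ((4 - (2 * si) ^ 2) / 4)) with ((4 - (2 * si) ^ 2) * Z / 4) by field.
      rewrite Hode. field. }
    replace (co * co + si * si) with 1 by lra.
    replace (co / si * Z * (co / si)) with (Z * (co * co) / (si * si)) by (field; lra).
    rewrite HZ. field. lra.
  - replace (locally 0) with (locally (0 - 0)) by (f_equal; ring).
    apply (filterlim_Rminus (at_right 0)); [|apply filterlim_id_at_right].
    apply (squeeze_0 (at_right 0) _ (fun s => 2 * K * chord s)).
    + generalize (at_right_lt 0 (PI / 3) PI_3_pos). apply filter_imp.
      intros s Hs. pose proof (chord_bounds s Hs) as Hc.
      assert (Hsin : 0 < sin (s / 2)) by (unfold chord in Hc; lra).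
      pose proof (cbSeries_bound 1 (chord s ^ 2) ltac:(nra)) as HB. fold K in HB.
      rewrite Rabs_mult. unfold Rdiv. rewrite Rabs_mult, (Rabs_right (/ _))
        by (apply Rle_ge, Rlt_le, Rinv_0_lt_compat; lra).
      replace (2 * K * chord s) with (chord s ^ 2 * K * (1 * / sin (s / 2)))
        by (unfold chord; field; lra).
      apply Rmult_le_compat; auto using Rabs_pos.
      * apply Rmult_le_pos; [apply Rabs_pos|apply Rlt_le, Rinv_0_lt_compat; lra].
      * apply Rmult_le_compat_r; [apply Rlt_le, Rinv_0_lt_compat; lra|apply cos_bound].
    + replace (locally 0) with (locally (2 * K * 0)) by (f_equal; ring).
      apply (filterlim_Rmult (at_right 0)); [apply filterlim_const|apply filterlim_chord_0].
Qed.

(** The classical expansion of 2 arcsin^2 x, with x = sin(t/2). *)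
Lemma cbSeries_2_chord (t : R) : 0 < t < PI / 3 -> cbSeries 2 (chord t ^ 2) = t ^ 2 / 2.
Proof.
  intros Ht.
  set (K := Series (fun n => (1 / 2) ^ S n)).
  assert (E : cbSeries 2 (chord t ^ 2) - t ^ 2 / 2 = 0); [|lra].
  apply (derivative_zero_limit (fun s => cbSeries 2 (chord s ^ 2) - s ^ 2 / 2) 0 (PI / 3) 0); auto.
  - intros s Hs. pose proof (cbSeries_chord_derive 1 s Hs) as HP.
    rewrite Rmult_comm, cbSeries_1_chord in HP by auto.
    assert (Hq : is_derive (fun s => s ^ 2 / 2) s s) by (auto_derive; [auto|field]).
    eapply is_derive_value.
    + exact (is_derive_minus (fun s => cbSeries 2 (chord s ^ 2)) _ s _ _ HP Hq).
    + unfold minus, plus, opp; simpl. ring.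
  - replace (locally 0) with (locally (0 - 0 ^ 2 / 2)) by (f_equal; field).
    apply (filterlim_Rminus (at_right 0)).
    + apply (squeeze_0 (at_right 0) _ (fun s => K * chord s)).
      * generalize (at_right_lt 0 (PI / 3) PI_3_pos). apply filter_imp.
        exact (cbSeries_chord_bound 2).
      * replace (locally 0) with (locally (K * 0)) by (f_equal; ring).
        apply (filterlim_Rmult (at_right 0)); [apply filterlim_const|apply filterlim_chord_0].
    + apply (continuous_at_right (fun s => s ^ 2 / 2)).
      apply (ex_derive_continuous (fun s => s ^ 2 / 2)). auto_derive. auto.
Qed.

(** * Polylogarithms along the arc 1 - e^(it) *)

(** The argument of 1 - e^(it), for t in (0, 2 pi). *)
Definition arg (t : R) : R := (t - PI) / 2.

Lemma cos_arg (t : R) : cos (arg t) = sin (t / 2).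
Proof.
  unfold arg. replace ((t - PI) / 2) with (t / 2 - PI / 2) by field.
  rewrite cos_minus, cos_PI2, sin_PI2. ring.
Qed.

Lemma sin_arg (t : R) : sin (arg t) = - cos (t / 2).
Proof.
  unfold arg. replace ((t - PI) / 2) with (t / 2 - PI / 2) by field.
  rewrite sin_minus, cos_PI2, sin_PI2. ring.
Qed.

(** Here 1 - w = e^(it), so that Li_1(w) = -ln(1 - w) = -it. *)
Lemma Li_1_chord (t : R) :
  0 < t < PI / 3 -> LiRe 1 (chord t) (arg t) = 0 /\ LiIm 1 (chord t) (arg t) = - t.
Proof.
  intros Ht. pose proof (chord_bounds t Ht) as Hc.
  destruct (Li_1 (chord t) (arg t) Hc) as [E1 E2]. rewrite E1, E2, cos_arg, sin_arg.
  unfold chord in *. split.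
  - replace (1 - 2 * (2 * sin (t / 2)) * sin (t / 2) + (2 * sin (t / 2)) ^ 2) with 1 by ring.
    rewrite ln_1. field.
  - replace (2 * sin (t / 2) * - cos (t / 2) / (1 - 2 * sin (t / 2) * sin (t / 2)))
      with (- tan t).
    + rewrite atan_opp, atan_tan; [reflexivity|lra].
    + unfold tan. replace t with (2 * (t / 2)) at 1 2 by field.
      rewrite sin_2a, cos_2a_sin. field.
      rewrite <- cos_2a_sin. replace (2 * (t / 2)) with t by field.
      apply Rgt_not_eq, cos_gt_0; lra.
Qed.

Lemma chord_derive (t : R) :
  0 < t < PI / 3 -> is_derive chord t (chord t * (cos (t / 2) / sin (t / 2) / 2)).
Proof.
  intros Ht. pose proof (chord_bounds t Ht) as Hc. unfold chord in *.
  auto_derive; [auto|]. change (t * / 2) with (t / 2). field. lra.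
Qed.

Lemma ln_chord_derive (t : R) :
  0 < t < PI / 3 -> is_derive (fun s => ln (chord s)) t (cos (t / 2) / sin (t / 2) / 2).
Proof.
  intros Ht. pose proof (chord_bounds t Ht) as Hc. unfold chord in *.
  auto_derive; change (t * / 2) with (t / 2); [lra|]. field. lra.
Qed.

Lemma Li_chord_derive (k : nat) (t : R) :
  0 < t < PI / 3 ->
  is_derive (fun s => LiRe (S k) (chord s) (arg s)) t
    (cos (t / 2) / sin (t / 2) / 2 * LiRe k (chord t) (arg t)
     - 1 / 2 * LiIm k (chord t) (arg t)) /\
  is_derive (fun s => LiIm (S k) (chord s) (arg s)) t
    (cos (t / 2) / sin (t / 2) / 2 * LiIm k (chord t) (arg t)
     + 1 / 2 * LiRe k (chord t) (arg t)).
Proof.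
  intros Ht. pose proof (chord_bounds t Ht) as Hc.
  apply (Li_derive_open k chord arg (fun s => cos (s / 2) / sin (s / 2) / 2) (fun _ => 1 / 2)).
  - rewrite Rabs_right; lra.
  - apply (ex_derive_continuous (fun s => cos (s / 2) / sin (s / 2) / 2)).
    unfold chord in Hc. auto_derive. change (t * / 2) with (t / 2). lra.
  - apply continuous_const.
  - apply (locally_interval 0 (PI / 3)); auto. intros s Hs. split.
    + now apply chord_derive.
    + unfold arg. auto_derive; [auto|field].
Qed.

(** ln(2 - 2 cos t) = 2 ln (2 sin(t/2)). *)
Lemma clausen_2_derive (t : R) :
  0 < t < PI / 3 -> is_derive (fun s => LiIm 2 1 s) t (- ln (chord t)).
Proof.
  intros Ht. pose proof (chord_bounds t Ht) as Hc.
  assert (E : 2 - 2 * cos t = chord t ^ 2).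
  { unfold chord. replace t with (2 * (t / 2)) at 1 by field. rewrite cos_2a_sin. ring. }
  destruct (Li_2_derive_circle t) as [H _]; [nra|].
  eapply is_derive_value; [exact H|]. rewrite E, ln_pow by lra. simpl. field.
Qed.

(** On this interval sin t / (1 - cos t) = cot(t/2) = tan(pi/2 - t/2). *)
Lemma cosine_2_derive (t : R) :
  0 < t < PI / 3 -> is_derive (fun s => LiRe 2 1 s) t ((t - PI) / 2).
Proof.
  intros Ht. pose proof (chord_bounds t Ht) as Hc.
  pose proof (cos_half_pos t Ht) as Hp. unfold chord in Hc.
  assert (E : 1 - cos t = 2 * (sin (t / 2) * sin (t / 2))).
  { replace t with (2 * (t / 2)) at 1 by field. rewrite cos_2a_sin. ring. }
  destruct (Li_2_derive_circle t) as [_ H]; [nra|].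
  eapply is_derive_value; [exact H|]. rewrite E.
  replace (sin t) with (2 * sin (t / 2) * cos (t / 2))
    by (rewrite <- sin_2a; f_equal; field).
  replace (2 * sin (t / 2) * cos (t / 2) / (2 * (sin (t / 2) * sin (t / 2))))
    with (tan (PI / 2 - t / 2)).
  - rewrite atan_tan; [field|lra].
  - unfold tan. rewrite sin_shift, cos_shift. field. lra.
Qed.

(** With u = -(ln r)/2 > 0 one has sqrt r = exp(-u), and the Taylor bound u^a/a! <= exp u
    absorbs the power of the logarithm into one of the two factors sqrt r. *)
Lemma ln_pow_mul_le_sqrt (r : R) (a : nat) :
  0 < r < 1 -> Rabs (ln r) ^ a * r <= 2 ^ a * INR (Factorial.fact a) * sqrt r.
Proof.
  intros Hr.
  assert (Hln : ln r < 0) by (rewrite <- ln_1; apply ln_increasing; lra).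
  set (u := - ln r / 2). assert (Hu : 0 < u) by (unfold u; lra).
  assert (Hs : sqrt r = exp (- u)).
  { apply Rsqr_inj; [apply sqrt_pos|apply Rlt_le, exp_pos|].
    rewrite Rsqr_sqrt by lra. unfold Rsqr. rewrite <- exp_plus.
    replace (- u + - u) with (ln r) by (unfold u; field). now rewrite exp_ln. }
  assert (Htay : u ^ a / INR (Factorial.fact a) <= exp u).
  { eapply Rle_trans; [|apply (exp_ge_taylor u a); lra].
    destruct a as [|a]; [simpl; lra|]. rewrite tech5.
    rewrite <- (Rplus_0_l (u ^ S a / _)) at 1. apply Rplus_le_compat_r.
    apply cond_pos_sum. intros k. apply Rmult_le_pos; [apply pow_le; lra|].
    apply Rlt_le, Rinv_0_lt_compat, INR_fact_lt_0. }
  assert (Hr2 : r = sqrt r * sqrt r) by (symmetry; apply sqrt_sqrt; lra).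
  pose proof (INR_fact_lt_0 a) as Hf.
  rewrite Rabs_left by lra. replace (- ln r) with (2 * u) by (unfold u; field).
  rewrite Rpow_mult_distr, Hr2 at 1. rewrite <- !Rmult_assoc.
  apply Rmult_le_compat_r; [apply sqrt_pos|]. rewrite !Rmult_assoc.
  apply Rmult_le_compat_l; [apply pow_le; lra|].
  assert (Hq : sqrt r * exp u = 1).
  { rewrite Hs, <- exp_plus. rewrite Rplus_opp_l. apply exp_0. }
  assert (Hsp : 0 <= sqrt r) by apply sqrt_pos.
  apply Rle_trans with (INR (Factorial.fact a) * (exp u * sqrt r)).
  - rewrite <- Rmult_assoc. apply Rmult_le_compat_r; auto.
    apply (Rmult_le_compat_r (INR (Factorial.fact a))) in Htay; [|lra].
    unfold Rdiv in Htay. rewrite Rmult_assoc, Rinv_l in Htay by lra. lra.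
  - rewrite (Rmult_comm (exp u)), Hq. lra.
Qed.

Lemma ln_chord_vanish (f : R -> R) (K : R) (a : nat) :
  (forall t, 0 < t < PI / 3 -> Rabs (f t) <= K * chord t) ->
  filterlim (fun t => ln (chord t) ^ a * f t) (at_right 0) (locally 0).
Proof.
  intros Hf.
  apply (squeeze_0 (at_right 0) _
    (fun t => K * (2 ^ a * INR (Factorial.fact a)) * sqrt (chord t))).
  - generalize (at_right_lt 0 (PI / 3) PI_3_pos). apply filter_imp.
    intros t Ht. pose proof (chord_bounds t Ht) as Hc.
    pose proof (ln_pow_mul_le_sqrt _ a Hc) as Hl. specialize (Hf t Ht).
    assert (HK : 0 <= K).
    { apply Rmult_le_reg_r with (chord t); [lra|]. rewrite Rmult_0_l.
      eapply Rle_trans; [apply Rabs_pos|exact Hf]. }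
    rewrite Rabs_mult, <- RPow_abs.
    apply Rle_trans with (Rabs (ln (chord t)) ^ a * (K * chord t)).
    + apply Rmult_le_compat_l; auto. apply pow_le, Rabs_pos.
    + replace (Rabs (ln (chord t)) ^ a * (K * chord t))
        with (K * (Rabs (ln (chord t)) ^ a * chord t)) by ring.
      rewrite (Rmult_assoc K). now apply Rmult_le_compat_l.
  - replace (locally 0) with (locally (K * (2 ^ a * INR (Factorial.fact a)) * sqrt 0))
      by (f_equal; rewrite sqrt_0; ring).
    apply (filterlim_Rmult (at_right 0)); [apply filterlim_const|].
    apply (filterlim_comp _ _ _ chord sqrt (at_right 0) (locally 0));
      [apply filterlim_chord_0|apply continuous_sqrt].
Qed.

Lemma id_le_chord (t : R) : 0 < t < PI / 3 -> Rabs t <= 2 * chord t.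
Proof.
  intros Ht. rewrite Rabs_right by lra.
  destruct (MVT_gen chord 0 t (fun s => cos (s / 2))) as [c [Hc E]].
  - intros s _. unfold chord. auto_derive; auto. change (s * / 2) with (s / 2). field.
  - intros s _. apply continuity_pt_filterlim, (ex_derive_continuous chord).
    unfold chord. auto_derive. auto.
  - rewrite Rmin_left, Rmax_right in Hc by lra.
    unfold chord at 2 in E. rewrite Rdiv_0_l, sin_0 in E.
    assert (1 / 2 <= cos (c / 2)).
    { rewrite <- cos_PI3. apply cos_decr_1; lra. }
    nra.
Qed.

Lemma Li_chord_bound (c : R -> R) (k : nat) (t : R) :
  (forall x, Rabs (c x) <= 1) -> (2 <= k)%nat -> 0 < t < PI / 3 ->
  Rabs (trigLi c k (chord t) (arg t)) <= Series (fun n => / INR (S n) ^ 2) * chord t.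
Proof.
  intros Hc Hk Ht. pose proof (chord_bounds t Ht). rewrite Rmult_comm.
  apply trigLi_bound; auto. lra.
Qed.

Lemma chord_PI3 : chord (PI / 3) = 1.
Proof. unfold chord. replace (PI / 3 / 2) with (PI / 6) by field. rewrite sin_PI6. field. Qed.

Lemma filterlim_chord_PI3 : filterlim chord (at_left (PI / 3)) (locally 1).
Proof.
  rewrite <- chord_PI3.
  apply continuous_at_left, (ex_derive_continuous chord). unfold chord. auto_derive. auto.
Qed.

Lemma chord_le_1_at_left : at_left (PI / 3) (fun t => 0 < chord t < 1).
Proof.
  generalize (at_left_lt 0 (PI / 3) PI_3_pos). apply filter_imp. apply chord_bounds.
Qed.

Lemma LiRe_opp (k : nat) (r b : R) : LiRe k r (- b) = LiRe k r b.
Proof.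
  unfold LiRe, trigLi. apply Series_ext. intros n.
  now rewrite Ropp_mult_distr_r_reverse, cos_neg.
Qed.

Lemma LiIm_opp (k : nat) (r b : R) : LiIm k r (- b) = - LiIm k r b.
Proof.
  unfold LiIm, trigLi. rewrite <- Series_opp. apply Series_ext. intros n.
  rewrite Ropp_mult_distr_r_reverse, sin_neg. unfold Rdiv. ring.
Qed.

Lemma filterlim_arg_PI3 : filterlim arg (at_left (PI / 3)) (locally (- (PI / 3))).
Proof.
  replace (- (PI / 3)) with (arg (PI / 3)) by (unfold arg; field).
  apply continuous_at_left, (ex_derive_continuous arg). unfold arg. auto_derive. auto.
Qed.

Lemma Li_chord_PI3 (k : nat) :
  (2 <= k)%nat ->
  filterlim (fun t => LiRe k (chord t) (arg t)) (at_left (PI / 3)) (locally (LiRe k 1 (PI / 3))) /\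
  filterlim (fun t => LiIm k (chord t) (arg t)) (at_left (PI / 3)) (locally (- LiIm k 1 (PI / 3))).
Proof.
  intros Hk. rewrite <- LiRe_opp, <- LiIm_opp.
  assert (Hr : at_left (PI / 3) (fun t => Rabs (chord t) <= 1)).
  { generalize chord_le_1_at_left. apply filter_imp. intros t Ht. rewrite Rabs_right; lra. }
  split.
  - apply (trigLi_limit_closed cos cos_bound continuous_cos (at_left (PI / 3)));
      auto using filterlim_chord_PI3, filterlim_arg_PI3.
  - apply (trigLi_limit_closed sin sin_bound continuous_sin (at_left (PI / 3)));
      auto using filterlim_chord_PI3, filterlim_arg_PI3.
Qed.

Lemma cbSeries_chord_PI3 (k : nat) :
  filterlim (fun t => cbSeries k (chord t ^ 2)) (at_left (PI / 3)) (locally (cbSeries k 1)).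
Proof.
  replace (cbSeries k 1) with (cbSeries k (1 ^ 2)) by (f_equal; ring).
  apply (cbSeries_limit (at_left (PI / 3))).
  - generalize chord_le_1_at_left. apply filter_imp. intros t Ht. nra.
  - apply (filterlim_Rpow (at_left (PI / 3))), filterlim_chord_PI3.
Qed.

Lemma Li_circle_at {k : nat} (c : R -> R) (F : (R -> Prop) -> Prop) {FF : ProperFilter F} (x : R) :
  (forall y, Rabs (c y) <= 1) -> (forall y, continuous c y) -> (2 <= k)%nat ->
  filterlim (fun t : R => t) F (locally x) ->
  filterlim (fun t => trigLi c k 1 t) F (locally (trigLi c k 1 x)).
Proof.
  intros Hc Hcc Hk Hx. apply (trigLi_limit_closed c Hc Hcc F); auto.
  - apply filter_forall. intros _. rewrite Rabs_R1. lra.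
  - apply filterlim_const.
Qed.

(** * The primitive and its boundary values *)

(** A primitive of -(4/3) t L^3 when P_3, P_4, P_5 are the central binomial series; the last
    term is -(4/3) L^3 P_2 with P_2 = t^2/2.  In this and the following definitions the
    arguments stand for the values at t of the functions named in [chord_primitive]. *)
Definition central_part (t L P3 P4 P5 : R) : R :=
  P5 - 2 * (L * P4) + 2 * (L ^ 2 * P3) - 2 / 3 * (L ^ 3 * t ^ 2).

(** The imaginary part of i (l^4 Li_1 - 4 l^3 Li_2 + 12 l^2 Li_3 - 24 l Li_4 + 24 Li_5), taken
    at w = 1 - e^(it) with l = L + i f = ln w, Li_1 = -it and Li_k = A_k + i B_k.  The bracket is
    obtained by integrating l^4 dw/(1 - w) by parts, so this is a primitive of Im l^4. *)
Definition log4_part (t L f A2 A3 A4 A5 B2 B3 B4 : R) : R :=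
  t * (4 * L ^ 3 * f - 4 * L * f ^ 3)
  - 4 * ((L ^ 3 - 3 * L * f ^ 2) * A2 - (3 * L ^ 2 * f - f ^ 3) * B2)
  + 12 * ((L ^ 2 - f ^ 2) * A3 - 2 * L * f * B3)
  - 24 * (L * A4 - f * B4) + 24 * A5.

(** Likewise a primitive of Re l^3: the real part of
    i (l^3 Li_1 - 3 l^2 Li_2 + 6 l Li_3 - 6 Li_4). *)
Definition log3_part (t L f A2 A3 B2 B3 B4 : R) : R :=
  t * (L ^ 3 - 3 * L * f ^ 2)
  + 3 * ((L ^ 2 - f ^ 2) * B2 + 2 * L * f * A2)
  - 6 * (L * B3 + f * A3) + 6 * B4.

(** A primitive of q L, where q = 2 f^3 + 3 pi f^2: successive integration by parts gives
    -q S2 - q' C3 + q'' S4 + q''' C5, where S and C are the imaginary and real parts of the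
    polylogarithms at e^(it) and derivatives of q are taken in t, with f' = 1/2. *)
Definition clausen_part (f S2 C3 S4 C5 : R) : R :=
  (3 * f + 3 * PI / 2) * S4 + 3 / 2 * C5
  - (2 * f ^ 3 + 3 * PI * f ^ 2) * S2 - (3 * f ^ 2 + 3 * PI * f) * C3.

Definition primitive (t L f A2 A3 A4 A5 B2 B3 B4 P3 P4 P5 S2 C3 S4 C5 : R) : R :=
  central_part t L P3 P4 P5
  + 4 / 3 * (1 / 2 * log4_part t L f A2 A3 A4 A5 B2 B3 B4
             + PI * log3_part t L f A2 A3 B2 B3 B4 + clausen_part f S2 C3 S4 C5).

(** The identity behind the theorem: only the differential relations between the functions
    matter, the rest is polynomial algebra.  Here c = L' = cot(t/2)/2. *)
Lemma primitive_derive (L A2 A3 A4 A5 B2 B3 B4 P3 P4 P5 S2 C3 S4 C5 : R -> R) (t c : R) :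
  is_derive L t c ->
  is_derive A2 t (c * 0 - 1 / 2 * - t) -> is_derive B2 t (c * - t + 1 / 2 * 0) ->
  is_derive A3 t (c * A2 t - 1 / 2 * B2 t) -> is_derive B3 t (c * B2 t + 1 / 2 * A2 t) ->
  is_derive A4 t (c * A3 t - 1 / 2 * B3 t) -> is_derive B4 t (c * B3 t + 1 / 2 * A3 t) ->
  is_derive A5 t (c * A4 t - 1 / 2 * B4 t) ->
  is_derive P3 t (2 * c * (t ^ 2 / 2)) -> is_derive P4 t (2 * c * P3 t) ->
  is_derive P5 t (2 * c * P4 t) ->
  is_derive S2 t (- L t) -> is_derive C3 t (- S2 t) -> is_derive S4 t (C3 t) ->
  is_derive C5 t (- S4 t) ->
  is_derive (fun s => primitive s (L s) (arg s) (A2 s) (A3 s) (A4 s) (A5 s) (B2 s) (B3 s) (B4 s)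
                        (P3 s) (P4 s) (P5 s) (S2 s) (C3 s) (S4 s) (C5 s)) t 0.
Proof.
  intros HL HA2 HB2 HA3 HB3 HA4 HB4 HA5 HP3 HP4 HP5 HS2 HC3 HS4 HC5.
  unfold primitive, central_part, log4_part, log3_part, clausen_part, arg.
  auto_derive.
  - repeat match goal with |- _ /\ _ => split end; auto; eexists; eassumption.
  - repeat match goal with
    | H : is_derive ?g t _ |- _ => rewrite (Derive_eta g t _ H); clear H
    end.
    field.
Qed.

Ltac limits F :=
  repeat first
    [ eassumption
    | apply filterlim_const
    | apply (filterlim_Rpow F)
    | apply (filterlim_Rminus F)
    | apply (filterlim_Rplus F)
    | apply (filterlim_Rmult F) ].

Definition chord_primitive (t : R) : R :=
  primitive t (ln (chord t)) (arg t)
    (LiRe 2 (chord t) (arg t)) (LiRe 3 (chord t) (arg t))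
    (LiRe 4 (chord t) (arg t)) (LiRe 5 (chord t) (arg t))
    (LiIm 2 (chord t) (arg t)) (LiIm 3 (chord t) (arg t)) (LiIm 4 (chord t) (arg t))
    (cbSeries 3 (chord t ^ 2)) (cbSeries 4 (chord t ^ 2)) (cbSeries 5 (chord t ^ 2))
    (LiIm 2 1 t) (LiRe 3 1 t) (LiIm 4 1 t) (LiRe 5 1 t).

Lemma chord_primitive_derive (t : R) : 0 < t < PI / 3 -> is_derive chord_primitive t 0.
Proof.
  intros Ht. set (c := cos (t / 2) / sin (t / 2) / 2).
  destruct (Li_1_chord t Ht) as [E1 E2].
  destruct (Li_chord_derive 1 t Ht) as [HA2 HB2]. rewrite E1, E2 in HA2, HB2. fold c in HA2, HB2.
  destruct (Li_chord_derive 2 t Ht) as [HA3 HB3]. fold c in HA3, HB3.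
  destruct (Li_chord_derive 3 t Ht) as [HA4 HB4]. fold c in HA4, HB4.
  destruct (Li_chord_derive 4 t Ht) as [HA5 _]. fold c in HA5.
  pose proof (cbSeries_chord_derive 2 t Ht) as HP3. rewrite cbSeries_2_chord in HP3 by auto.
  pose proof (cbSeries_chord_derive 3 t Ht) as HP4.
  pose proof (cbSeries_chord_derive 4 t Ht) as HP5.
  replace (cos (t / 2) / sin (t / 2)) with (2 * c) in HP3, HP4, HP5
    by (unfold c, Rdiv; field; pose proof (chord_bounds t Ht); unfold chord, Rdiv in *; lra).
  destruct (Li_derive_circle 2 t ltac:(lia)) as [HC3 _].
  destruct (Li_derive_circle 3 t ltac:(lia)) as [_ HS4].
  destruct (Li_derive_circle 4 t ltac:(lia)) as [HC5 _].
  exact (primitive_derive (fun s => ln (chord s))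
    (fun s => LiRe 2 (chord s) (arg s)) (fun s => LiRe 3 (chord s) (arg s))
    (fun s => LiRe 4 (chord s) (arg s)) (fun s => LiRe 5 (chord s) (arg s))
    (fun s => LiIm 2 (chord s) (arg s)) (fun s => LiIm 3 (chord s) (arg s))
    (fun s => LiIm 4 (chord s) (arg s))
    (fun s => cbSeries 3 (chord s ^ 2)) (fun s => cbSeries 4 (chord s ^ 2))
    (fun s => cbSeries 5 (chord s ^ 2))
    (fun s => LiIm 2 1 s) (fun s => LiRe 3 1 s) (fun s => LiIm 4 1 s) (fun s => LiRe 5 1 s)
    t c (ln_chord_derive t Ht) HA2 HB2 HA3 HB3 HA4 HB4 HA5 HP3 HP4 HP5
    (clausen_2_derive t Ht) HC3 HS4 HC5).
Qed.

Lemma LiIm_circle_0 (k : nat) : LiIm k 1 0 = 0.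
Proof.
  rewrite <- Ropp_0 at 1. pose proof (LiIm_opp k 1 0) as H. rewrite Ropp_0 in *. lra.
Qed.

Lemma LiRe_circle_0 (k : nat) : LiRe k 1 0 = zeta k.
Proof.
  unfold LiRe, trigLi, zeta. apply Series_ext. intros n.
  rewrite pow1, Rmult_0_r, cos_0. unfold Rdiv. ring.
Qed.

(** Every term with w or with the central binomial series is a power of L times a quantity of
    order r, and tends to 0; only the Clausen part contributes. *)
Lemma chord_primitive_0 :
  filterlim chord_primitive (at_right 0) (locally (PI ^ 2 * zeta 3 + 2 * zeta 5)).
Proof.
  assert (Hid : filterlim (fun t : R => t) (at_right 0) (locally 0)) by apply filterlim_id_at_right.
  assert (Harg : filterlim arg (at_right 0) (locally (- (PI / 2)))).
  { replace (- (PI / 2)) with (arg 0) by (unfold arg; field).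
    apply continuous_at_right, (ex_derive_continuous arg). unfold arg. auto_derive. auto. }
  assert (HA : forall a k, (2 <= k)%nat ->
    filterlim (fun t => ln (chord t) ^ a * LiRe k (chord t) (arg t)) (at_right 0) (locally 0)).
  { intros a k Hk. eapply ln_chord_vanish. intros t Ht. apply Li_chord_bound; auto.
    apply cos_bound. }
  assert (HB : forall a k, (2 <= k)%nat ->
    filterlim (fun t => ln (chord t) ^ a * LiIm k (chord t) (arg t)) (at_right 0) (locally 0)).
  { intros a k Hk. eapply ln_chord_vanish. intros t Ht. apply Li_chord_bound; auto.
    apply sin_bound. }
  assert (HP : forall a k,
    filterlim (fun t => ln (chord t) ^ a * cbSeries k (chord t ^ 2)) (at_right 0) (locally 0)).
  { intros a k. eapply ln_chord_vanish. intros t Ht. now apply cbSeries_chord_bound. }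
  assert (HT : forall a,
    filterlim (fun t => ln (chord t) ^ a * t) (at_right 0) (locally 0)).
  { intros a. eapply ln_chord_vanish. exact id_le_chord. }
  pose proof (fun k Hk => Li_circle_at (k := k) sin (at_right 0) 0
                sin_bound continuous_sin Hk Hid) as HS.
  pose proof (fun k Hk => Li_circle_at (k := k) cos (at_right 0) 0
                cos_bound continuous_cos Hk Hid) as HC.
  pose proof (HA 0%nat 3%nat ltac:(lia)). pose proof (HA 0%nat 5%nat ltac:(lia)).
  pose proof (HA 0%nat 2%nat ltac:(lia)).
  pose proof (HA 1%nat 2%nat ltac:(lia)). pose proof (HA 3%nat 2%nat ltac:(lia)).
  pose proof (HA 2%nat 3%nat ltac:(lia)). pose proof (HA 1%nat 4%nat ltac:(lia)).
  pose proof (HB 0%nat 2%nat ltac:(lia)). pose proof (HB 2%nat 2%nat ltac:(lia)).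
  pose proof (HB 1%nat 3%nat ltac:(lia)). pose proof (HB 0%nat 4%nat ltac:(lia)).
  pose proof (HP 0%nat 5%nat). pose proof (HP 1%nat 4%nat). pose proof (HP 2%nat 3%nat).
  pose proof (HT 1%nat). pose proof (HT 3%nat).
  pose proof (HS 2%nat ltac:(lia)). pose proof (HS 4%nat ltac:(lia)).
  pose proof (HC 3%nat ltac:(lia)). pose proof (HC 5%nat ltac:(lia)).
  clear HA HB HP HT HS HC.
  (* Regrouping so that every power of the logarithm multiplies a quantity of order chord t. *)
  apply filterlim_ext with (fun t =>
    ln (chord t) ^ 0 * cbSeries 5 (chord t ^ 2)
    - 2 * (ln (chord t) ^ 1 * cbSeries 4 (chord t ^ 2))
    + 2 * (ln (chord t) ^ 2 * cbSeries 3 (chord t ^ 2))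
    - 2 / 3 * (ln (chord t) ^ 3 * t * t)
    + 4 / 3 * (1 / 2 *
        (4 * (ln (chord t) ^ 3 * t * arg t) - 4 * (ln (chord t) ^ 1 * t * arg t ^ 3)
         - 4 * (ln (chord t) ^ 3 * LiRe 2 (chord t) (arg t)
                - 3 * arg t ^ 2 * (ln (chord t) ^ 1 * LiRe 2 (chord t) (arg t))
                - (3 * arg t * (ln (chord t) ^ 2 * LiIm 2 (chord t) (arg t))
                   - arg t ^ 3 * (ln (chord t) ^ 0 * LiIm 2 (chord t) (arg t))))
         + 12 * (ln (chord t) ^ 2 * LiRe 3 (chord t) (arg t)
                 - arg t ^ 2 * (ln (chord t) ^ 0 * LiRe 3 (chord t) (arg t))
                 - 2 * arg t * (ln (chord t) ^ 1 * LiIm 3 (chord t) (arg t)))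
         - 24 * (ln (chord t) ^ 1 * LiRe 4 (chord t) (arg t)
                 - arg t * (ln (chord t) ^ 0 * LiIm 4 (chord t) (arg t)))
         + 24 * (ln (chord t) ^ 0 * LiRe 5 (chord t) (arg t)))
      + PI * (ln (chord t) ^ 3 * t - 3 * arg t ^ 2 * (ln (chord t) ^ 1 * t)
         + 3 * (ln (chord t) ^ 2 * LiIm 2 (chord t) (arg t)
                - arg t ^ 2 * (ln (chord t) ^ 0 * LiIm 2 (chord t) (arg t))
                + 2 * arg t * (ln (chord t) ^ 1 * LiRe 2 (chord t) (arg t)))
         - 6 * (ln (chord t) ^ 1 * LiIm 3 (chord t) (arg t)
                + arg t * (ln (chord t) ^ 0 * LiRe 3 (chord t) (arg t)))
         + 6 * (ln (chord t) ^ 0 * LiIm 4 (chord t) (arg t)))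
      + ((3 * arg t + 3 * PI / 2) * LiIm 4 1 t + 3 / 2 * LiRe 5 1 t
         - (2 * arg t ^ 3 + 3 * PI * arg t ^ 2) * LiIm 2 1 t
         - (3 * arg t ^ 2 + 3 * PI * arg t) * LiRe 3 1 t))).
  { intros t. unfold chord_primitive, primitive, central_part, log4_part, log3_part, clausen_part.
    field. }
  eapply filterlim_value; [solve [limits (at_right 0)]|].
  change (trigLi sin) with LiIm. change (trigLi cos) with LiRe.
  rewrite !LiIm_circle_0, !LiRe_circle_0. field.
Qed.

(** Here r = 1, L = 0 and w = e^(-i pi/3).  The contributions of Im Li_2 cancel between the
    three parts. *)
Lemma chord_primitive_PI3 :
  filterlim chord_primitive (at_left (PI / 3))
    (locally (cbSeries 5 1 + 8 / 3 * PI ^ 2 * LiRe 3 1 (PI / 3) - 2 * PI * LiIm 4 1 (PI / 3)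
              + 18 * LiRe 5 1 (PI / 3))).
Proof.
  assert (Hid : filterlim (fun t : R => t) (at_left (PI / 3)) (locally (PI / 3)))
    by apply filterlim_id_at_left.
  pose proof filterlim_arg_PI3 as Harg.
  assert (HL : filterlim (fun t => ln (chord t)) (at_left (PI / 3)) (locally 0)).
  { rewrite <- ln_1. apply (filterlim_comp _ _ _ chord ln (at_left (PI / 3)) (locally 1)).
    - apply filterlim_chord_PI3.
    - apply (ex_derive_continuous ln). auto_derive. lra. }
  pose proof (fun k Hk => Li_circle_at (k := k) sin (at_left (PI / 3)) (PI / 3)
                sin_bound continuous_sin Hk Hid) as HS.
  pose proof (fun k Hk => Li_circle_at (k := k) cos (at_left (PI / 3)) (PI / 3)
                cos_bound continuous_cos Hk Hid) as HC.
  pose proof (fun k Hk => proj1 (Li_chord_PI3 k Hk)) as HA.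
  pose proof (fun k Hk => proj2 (Li_chord_PI3 k Hk)) as HB.
  pose proof (HA 2%nat ltac:(lia)). pose proof (HA 3%nat ltac:(lia)).
  pose proof (HA 4%nat ltac:(lia)). pose proof (HA 5%nat ltac:(lia)).
  pose proof (HB 2%nat ltac:(lia)). pose proof (HB 3%nat ltac:(lia)).
  pose proof (HB 4%nat ltac:(lia)).
  pose proof (HS 2%nat ltac:(lia)). pose proof (HS 4%nat ltac:(lia)).
  pose proof (HC 3%nat ltac:(lia)). pose proof (HC 5%nat ltac:(lia)).
  pose proof (cbSeries_chord_PI3 3). pose proof (cbSeries_chord_PI3 4).
  pose proof (cbSeries_chord_PI3 5). clear HA HB HS HC.
  unfold chord_primitive, primitive, central_part, log4_part, log3_part, clausen_part.
  eapply filterlim_value; [solve [limits (at_left (PI / 3))]|].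
  change (trigLi sin) with LiIm. change (trigLi cos) with LiRe.
  field.
Qed.

Theorem cbSeries_5_clausen :
  cbSeries 5 1 = PI ^ 2 * zeta 3 + 2 * zeta 5 - 8 / 3 * PI ^ 2 * LiRe 3 1 (PI / 3)
                 + 2 * PI * LiIm 4 1 (PI / 3) - 18 * LiRe 5 1 (PI / 3).
Proof.
  pose proof (derivative_zero_limits _ 0 (PI / 3) _ _ PI_3_pos
                chord_primitive_derive chord_primitive_0 chord_primitive_PI3). lra.
Qed.

(** * Values at the sixth roots of unity *)

Lemma sum_blocks (p : nat) (a : nat -> R) (N : nat) :
  sum_f_R0 (fun n => sum_f_R0 (fun j => a (S p * n + j)%nat) p) N = sum_f_R0 a (S p * N + p).
Proof.
  induction N as [|N IH].
  - rewrite Nat.mul_0_r. simpl. apply sum_eq. intros i _. f_equal; lia.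
  - rewrite tech5, IH, (tech2 a (S p * N + p) (S p * S N + p)) by nia.
    f_equal. replace (S p * S N + p - S (S p * N + p))%nat with p by nia.
    apply sum_eq. intros i _. f_equal; nia.
Qed.

Lemma Series_sum_f_R0 (u : nat -> nat -> R) (p : nat) :
  (forall j, (j <= p)%nat -> ex_series (u j)) ->
  ex_series (fun n => sum_f_R0 (fun j => u j n) p) /\
  Series (fun n => sum_f_R0 (fun j => u j n) p) = sum_f_R0 (fun j => Series (u j)) p.
Proof.
  induction p as [|p IH]; intros Hu; simpl.
  - split; [|reflexivity]. apply (Hu 0%nat); lia.
  - destruct IH as [H1 H2]; [intros j Hj; apply Hu; lia|]. split.
    + apply (ex_series_plus (V := R_NormedModule)); [exact H1|apply Hu; lia].
    + rewrite Series_plus, H2; auto.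
Qed.

(** An absolutely convergent series is the sum of its subseries over the residue classes. *)
Lemma Series_residues (p : nat) (a : nat -> R) :
  (forall n, Rabs (a n) <= / INR (S n) ^ 2) ->
  Series a = sum_f_R0 (fun j => Series (fun n => a (S p * n + j)%nat)) p.
Proof.
  intros Ha.
  assert (HM : ex_series (fun n => / INR (S n) ^ 2)) by (apply ex_series_inv_pow; lia).
  assert (Hex : forall j, (j <= p)%nat -> ex_series (fun n => a (S p * n + j)%nat)).
  { intros j _. apply ex_series_dominated with (fun n => / INR (S n) ^ 2); auto.
    intros n. eapply Rle_trans; [apply Ha|]. apply Rinv_le_contravar.
    - pose proof (INR_S_pow_ge_1 n 2). lra.
    - apply pow_incr. split; [apply pos_INR|apply le_INR; nia]. }
  destruct (Series_sum_f_R0 (fun j n => a (S p * n + j)%nat) p Hex) as [Hs <-].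
  pose proof (Series_correct _ (ex_series_dominated _ _ HM Ha)) as Hc.
  apply is_series_Reals in Hc. symmetry. apply is_series_unique, is_series_Reals.
  intros eps Heps. destruct (Hc eps Heps) as [N HN]. exists N. intros n Hn.
  rewrite sum_blocks. apply HN. nia.
Qed.

(** The sum of n^(-s) over the positive integers n congruent to j + 1 modulo p, for j < p. *)
Definition residueSeries (p j s : nat) : R := Series (fun n => / INR (S (p * n + j)) ^ s).

Lemma inv_pow_bound (m n s : nat) :
  (2 <= s)%nat -> (n <= m)%nat -> Rabs (/ INR (S m) ^ s) <= / INR (S n) ^ 2.
Proof.
  intros Hs Hm. pose proof (INR_S_pow_ge_1 m s).
  rewrite Rabs_right by (apply Rle_ge, Rlt_le, Rinv_0_lt_compat; lra).
  apply Rinv_le_contravar.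
  - pose proof (INR_S_pow_ge_1 n 2). lra.
  - apply Rle_trans with (INR (S m) ^ 2).
    + apply pow_incr. split; [apply pos_INR|apply le_INR; lia].
    + apply Rle_pow; auto using INR_S_ge_1.
Qed.

(** A residue class modulo p is the union of q + 1 classes modulo p (q + 1). *)
Lemma residueSeries_refine (p j s q : nat) :
  (2 <= s)%nat -> (0 < p)%nat ->
  residueSeries p j s = sum_f_R0 (fun i => residueSeries (p * S q) (p * i + j) s) q.
Proof.
  intros Hs Hp. unfold residueSeries. rewrite (Series_residues q).
  - apply sum_eq. intros i _. apply Series_ext. intros n. do 3 f_equal. nia.
  - intros n. apply inv_pow_bound; auto. nia.
Qed.

(** Multiplication by c maps the class of j + 1 modulo p onto that of c (j + 1) modulo c p;
    the term c * S j - 1 accounts for the shift by one in the index. *)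
Lemma residueSeries_scale (c p j s : nat) :
  (0 < c)%nat ->
  residueSeries (c * p) (c * S j - 1) s = residueSeries p j s / INR c ^ s.
Proof.
  intros Hc. unfold residueSeries, Rdiv. rewrite <- Series_scal_r. apply Series_ext. intros n.
  rewrite <- Rinv_mult, <- Rpow_mult_distr, <- mult_INR. do 3 f_equal. nia.
Qed.

Lemma zeta_residueSeries (s : nat) : zeta s = residueSeries 1 0 s.
Proof. unfold zeta, residueSeries. apply Series_ext. intros n. do 3 f_equal. lia. Qed.

(** The multiples of 2, of 3 and of 6 contribute zeta(s) divided by 2^s, 3^s and 6^s. *)
Lemma residues_mod_6 (s : nat) :
  (2 <= s)%nat ->
  residueSeries 6 0 s + residueSeries 6 4 s
    = zeta s * (1 - / 2 ^ s - / 3 ^ s + / 6 ^ s) /\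
  residueSeries 6 1 s + residueSeries 6 3 s = zeta s * (/ 2 ^ s - / 6 ^ s) /\
  residueSeries 6 2 s = zeta s * (/ 3 ^ s - / 6 ^ s) /\
  residueSeries 6 5 s = zeta s * / 6 ^ s.
Proof.
  intros Hs. rewrite zeta_residueSeries.
  pose proof (residueSeries_refine 1 0 s 5 Hs ltac:(lia)) as H1.
  pose proof (residueSeries_refine 2 1 s 2 Hs ltac:(lia)) as H2.
  pose proof (residueSeries_refine 3 2 s 1 Hs ltac:(lia)) as H3.
  pose proof (residueSeries_scale 2 1 0 s ltac:(lia)) as H4.
  pose proof (residueSeries_scale 3 1 0 s ltac:(lia)) as H5.
  pose proof (residueSeries_scale 6 1 0 s ltac:(lia)) as H6.
  simpl in *. unfold Rdiv in *.
  replace (1 + 1 + 1 + 1 + 1 + 1) with 6 in * by ring.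
  replace (1 + 1 + 1) with 3 in * by ring. replace (1 + 1) with 2 in * by ring.
  repeat split; lra.
Qed.

Lemma trigLi_PI3 (c : R -> R) (s : nat) :
  (forall x, Rabs (c x) <= 1) -> (forall x k, c (x + 2 * INR k * PI) = c x) -> (2 <= s)%nat ->
  trigLi c s 1 (PI / 3)
    = sum_f_R0 (fun j => c (INR (S j) * (PI / 3)) * residueSeries 6 j s) 5.
Proof.
  intros Hc Hper Hs. unfold trigLi. rewrite (Series_residues 5).
  - apply sum_eq. intros j _. unfold residueSeries. rewrite <- Series_scal_l.
    apply Series_ext. intros n. rewrite pow1. unfold Rdiv. rewrite Rmult_1_l. f_equal.
    rewrite <- (Hper (INR (S j) * (PI * / 3)) n). f_equal.
    rewrite S_INR, plus_INR, mult_INR, (S_INR j). simpl (INR 6). field.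
  - intros n. apply trigLi_term_bound; auto.
    apply closed_disc_majorant; auto. rewrite Rabs_R1. lra.
Qed.

Lemma cos_sin_sixths :
  let x := PI / 3 in
  (cos x = 1 / 2 /\ cos (2 * x) = - (1 / 2) /\ cos (3 * x) = -1 /\
   cos (4 * x) = - (1 / 2) /\ cos (5 * x) = 1 / 2 /\ cos (6 * x) = 1) /\
  (sin x = sqrt 3 / 2 /\ sin (2 * x) = sqrt 3 / 2 /\ sin (3 * x) = 0 /\
   sin (4 * x) = - (sqrt 3 / 2) /\ sin (5 * x) = - (sqrt 3 / 2) /\ sin (6 * x) = 0).
Proof.
  intros x. unfold x.
  assert (H3 : 3 * (PI / 3) = PI) by field.
  assert (Hc2 : cos (2 * (PI / 3)) = - (1 / 2)) by (rewrite cos_2a_cos, cos_PI3; field).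
  assert (Hs2 : sin (2 * (PI / 3)) = sqrt 3 / 2) by (rewrite sin_2a, cos_PI3, sin_PI3; field).
  replace (4 * (PI / 3)) with (PI / 3 + PI) by field.
  replace (5 * (PI / 3)) with (2 * (PI / 3) + PI) by field.
  replace (6 * (PI / 3)) with (2 * PI) by field.
  rewrite H3, !neg_cos, !neg_sin, Hc2, Hs2, cos_PI3, sin_PI3, cos_PI, sin_PI, cos_2PI, sin_2PI.
  repeat split; ring.
Qed.

Lemma LiRe_PI3 (s : nat) :
  (2 <= s)%nat ->
  LiRe s 1 (PI / 3) = zeta s * (1 / 2 - / 2 ^ s - 3 / 2 * / 3 ^ s + 3 * / 6 ^ s).
Proof.
  intros Hs. unfold LiRe. rewrite (trigLi_PI3 cos s cos_bound cos_period Hs).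
  destruct (residues_mod_6 s Hs) as [H1 [H2 [H3 H4]]].
  destruct cos_sin_sixths as [[C1 [C2 [C3 [C4 [C5 C6]]]]] _].
  unfold sum_f_R0. simpl (INR _).
  replace (1 + 1 + 1 + 1 + 1 + 1) with 6 by ring.
  replace (1 + 1 + 1 + 1 + 1) with 5 by ring. replace (1 + 1 + 1 + 1) with 4 by ring.
  replace (1 + 1 + 1) with 3 by ring. replace (1 + 1) with 2 by ring. rewrite Rmult_1_l.
  rewrite C1, C2, C3, C4, C5, C6. lra.
Qed.

(** The signs of sin(n pi/3) have period 6; doubling relates the even classes modulo 6 to
    classes modulo 3, which reduces everything to the two nonzero classes modulo 3.  Their sums
    are 1 + c8 and the rest of (1 - 3^(-4)) zeta(4). *)
Lemma LiIm_4_PI3 :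
  LiIm 4 1 (PI / 3) = 9 * sqrt 3 / 16 * (2 * (1 + c8) - 80 / 81 * zeta 4).
Proof.
  unfold LiIm. rewrite (trigLi_PI3 sin 4 sin_bound sin_period) by lia.
  destruct cos_sin_sixths as [_ [C1 [C2 [C3 [C4 [C5 C6]]]]]].
  pose proof (residueSeries_refine 1 0 4 2 ltac:(lia) ltac:(lia)) as H1.
  pose proof (residueSeries_refine 3 0 4 1 ltac:(lia) ltac:(lia)) as H2.
  pose proof (residueSeries_refine 3 1 4 1 ltac:(lia) ltac:(lia)) as H3.
  pose proof (residueSeries_scale 2 3 0 4 ltac:(lia)) as H4.
  pose proof (residueSeries_scale 2 3 1 4 ltac:(lia)) as H5.
  pose proof (residueSeries_scale 3 1 0 4 ltac:(lia)) as H6.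
  assert (H7 : residueSeries 3 0 4 = 1 + c8).
  { unfold residueSeries. rewrite Series_incr_1.
    - f_equal; [simpl; field|]. apply Series_ext. intros n. do 3 f_equal. lia.
    - apply ex_series_dominated with (fun n => / INR (S n) ^ 2).
      + apply ex_series_inv_pow; lia.
      + intros n. apply inv_pow_bound; lia. }
  rewrite zeta_residueSeries.
  unfold sum_f_R0 in *. simpl (INR _) in *. simpl Nat.mul in *. simpl Nat.add in *.
  simpl Nat.sub in *.
  replace (1 + 1 + 1 + 1 + 1 + 1) with 6 in * by ring.
  replace (1 + 1 + 1 + 1 + 1) with 5 in * by ring. replace (1 + 1 + 1 + 1) with 4 in * by ring.
  replace (1 + 1 + 1) with 3 in * by ring. replace (1 + 1) with 2 in * by ring.
  rewrite Rmult_1_l.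
  rewrite C1, C2, C3, C4, C5, C6, <- H7.
  replace (2 ^ 4) with 16 in * by ring. replace (3 ^ 4) with 81 in * by ring.
  set (z := residueSeries 1 0 4) in *.
  replace z with (81 / 80 * (residueSeries 3 0 4 + residueSeries 3 1 4)) by lra.
  rewrite H2, H3 in *.
  replace (residueSeries 6 1 4) with ((residueSeries 6 0 4 + residueSeries 6 3 4) / 16) by lra.
  set (u := residueSeries 6 0 4) in *. set (v := residueSeries 6 4 4) in *.
  set (w := residueSeries 6 3 4) in *. set (y := residueSeries 6 1 4) in *.
  assert (Ew : w = (y + v) / 16) by lra. assert (Ey : y = (u + w) / 16) by lra.
  assert (E : u + y - w - v = 9 / 8 * (u + w - (y + v))) by lra.
  replace (sqrt 3 / 2 * u + sqrt 3 / 2 * ((u + w) / 16) + 0 * residueSeries 6 2 4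
           + - (sqrt 3 / 2) * w + - (sqrt 3 / 2) * v + 0 * residueSeries 6 5 4)
    with (sqrt 3 / 2 * (u + y - w - v)) by (rewrite Ey at 1; ring).
  rewrite E. field_simplify. rewrite Ey. field.
Qed.

(** Integrating the derivative (t - pi)/2 of Re Li_2(e^(it)) shows that Re Li_2, Im Li_3 and
    Re Li_4 are polynomials in t on (0, pi/3) with coefficients in pi, zeta(2) and zeta(4).
    The values of Re Li_2 and Re Li_4 at pi/3 are known rational multiples of zeta(2) and
    zeta(4), which determines first zeta(2) and then zeta(4). *)
Lemma zeta_4 : zeta 4 = PI ^ 4 / 90.
Proof.
  set (C2 := fun t => LiRe 2 1 t - (zeta 2 - PI * t / 2 + t ^ 2 / 4)).
  set (S3 := fun t => LiIm 3 1 t - (zeta 2 * t - PI * t ^ 2 / 4 + t ^ 3 / 12)).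
  set (C4 := fun t => LiRe 4 1 t
                     - (zeta 4 - zeta 2 * t ^ 2 / 2 + PI * t ^ 3 / 12 - t ^ 4 / 48)).
  pose proof PI_3_pos as Hpi.
  assert (Hpoly : forall (p : R -> R) (t l : R), is_derive p t l -> continuous p t)
    by (intros p t l Hp; apply (ex_derive_continuous p); now exists l).
  assert (D2 : forall t, is_derive (fun t => zeta 2 - PI * t / 2 + t ^ 2 / 4) t ((t - PI) / 2))
    by (intros t; auto_derive; [auto|field]).
  assert (D3 : forall t, is_derive (fun t => zeta 2 * t - PI * t ^ 2 / 4 + t ^ 3 / 12) t
                           (zeta 2 - PI * t / 2 + t ^ 2 / 4))
    by (intros t; auto_derive; [auto|field]).
  assert (D4 : forall t, is_derive
                 (fun t => zeta 4 - zeta 2 * t ^ 2 / 2 + PI * t ^ 3 / 12 - t ^ 4 / 48) t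
                 (- (zeta 2 * t - PI * t ^ 2 / 4 + t ^ 3 / 12)))
    by (intros t; auto_derive; [auto|field]).
  assert (HLim : forall F (FF : ProperFilter F) (c p : R -> R) (k : nat) (x : R),
    (forall y, Rabs (c y) <= 1) -> (forall y, continuous c y) -> (2 <= k)%nat ->
    filterlim (fun t : R => t) F (locally x) -> continuous p x ->
    filterlim (fun t => trigLi c k 1 t - p t) F (locally (trigLi c k 1 x - p x))).
  { intros F FF c p k x Hc Hcc Hk Hx Hp. apply (filterlim_Rminus F).
    - apply (Li_circle_at c F); auto.
    - apply (filterlim_comp _ _ _ (fun t => t) p F (locally x)); auto. }
  assert (E2 : forall t, 0 < t < PI / 3 -> is_derive C2 t 0).
  { intros t Ht. eapply is_derive_value.
    - exact (is_derive_minus _ _ t _ _ (cosine_2_derive t Ht) (D2 t)).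
    - unfold minus, plus, opp; simpl. ring. }
  pose proof (HLim (at_right 0) _ cos _ 2%nat 0 cos_bound continuous_cos ltac:(lia)
                (filterlim_id_at_right 0) (Hpoly _ _ _ (D2 0))) as L2.
  pose proof (HLim (at_left (PI / 3)) _ cos _ 2%nat (PI / 3) cos_bound continuous_cos ltac:(lia)
                (filterlim_id_at_left (PI / 3)) (Hpoly _ _ _ (D2 (PI / 3)))) as R2.
  pose proof (derivative_zero_limits C2 _ _ _ _ Hpi E2 L2 R2) as V2.
  pose proof (derivative_zero_limit C2 _ _ _ E2 L2) as I2.
  change (trigLi cos) with LiRe in *. rewrite LiRe_circle_0 in *.
  assert (E3 : forall t, 0 < t < PI / 3 -> is_derive S3 t 0).
  { intros t Ht. eapply is_derive_value.
    - exact (is_derive_minus _ _ t _ _ (proj2 (Li_derive_circle 2 t ltac:(lia))) (D3 t)).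
    - unfold minus, plus, opp; simpl. specialize (I2 t Ht). unfold C2 in I2. lra. }
  pose proof (HLim (at_right 0) _ sin _ 3%nat 0 sin_bound continuous_sin ltac:(lia)
                (filterlim_id_at_right 0) (Hpoly _ _ _ (D3 0))) as L3.
  pose proof (derivative_zero_limit S3 _ _ _ E3 L3) as I3.
  change (trigLi sin) with LiIm in *. rewrite LiIm_circle_0 in *.
  assert (E4 : forall t, 0 < t < PI / 3 -> is_derive C4 t 0).
  { intros t Ht. eapply is_derive_value.
    - exact (is_derive_minus _ _ t _ _ (proj1 (Li_derive_circle 3 t ltac:(lia))) (D4 t)).
    - unfold minus, plus, opp; simpl. specialize (I3 t Ht). unfold S3 in I3. lra. }
  pose proof (HLim (at_right 0) _ cos _ 4%nat 0 cos_bound continuous_cos ltac:(lia)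
                (filterlim_id_at_right 0) (Hpoly _ _ _ (D4 0))) as L4.
  pose proof (HLim (at_left (PI / 3)) _ cos _ 4%nat (PI / 3) cos_bound continuous_cos ltac:(lia)
                (filterlim_id_at_left (PI / 3)) (Hpoly _ _ _ (D4 (PI / 3)))) as R4.
  pose proof (derivative_zero_limits C4 _ _ _ _ Hpi E4 L4 R4) as V4.
  change (trigLi cos) with LiRe in *. rewrite LiRe_circle_0 in *.
  rewrite LiRe_PI3 in V2, V4 by lia.
  assert (Z2 : zeta 2 = PI ^ 2 / 6) by lra.
  rewrite Z2 in V4. lra.
Qed.

Theorem mainTheorem4 :
  is_series (fun k : nat => 1 / (INR (S k) ^ 5 * central_binom (S k)))
    (9 / 4 * sqrt 3 * PI * c8 - 19 * zeta 5 / 3 + PI ^ 2 * zeta 3 / 9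
     + 9 * sqrt 3 * PI / 4 - PI ^ 5 / (27 * sqrt 3)).
Proof.
  replace (9 / 4 * sqrt 3 * PI * c8 - 19 * zeta 5 / 3 + PI ^ 2 * zeta 3 / 9
           + 9 * sqrt 3 * PI / 4 - PI ^ 5 / (27 * sqrt 3)) with (cbSeries 5 1).
  - apply (is_series_ext (fun n => 1 ^ S n / (INR (S n) ^ 5 * central_binom (S n)))).
    + intros n. now rewrite pow1.
    + apply Series_correct, ex_cbSeries. lra.
  - assert (Hs : sqrt 3 * sqrt 3 = 3) by (apply sqrt_sqrt; lra).
    assert (Hs0 : 0 < sqrt 3) by (apply sqrt_lt_R0; lra).
    replace (PI ^ 5 / (27 * sqrt 3)) with (PI ^ 5 * sqrt 3 / 81).
    + rewrite cbSeries_5_clausen, LiIm_4_PI3, !LiRe_PI3, zeta_4 by lia. field.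
    + replace (81) with (27 * (sqrt 3 * sqrt 3)) by lra. field. lra.
Qed.
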